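(* Let $d\in\mathbb{N}$, $\nu>0$ and $T>0$. Let $u_0:\mathbb{R}^d\to\mathbb{R}^d$ be divergence free, let $f:[0,T]\times\mathbb{R}^d\to\mathbb{R}^d$, and let $u:[0,T]\times\mathbb{R}^d\to\mathbb{R}^d$ be the (divergence-free) solution of the projected incompressible Navier-Stokes equation $$\partial_t u(t,x)+\mathbb{P}[u\cdot\nabla u](t,x)=\nu\Delta u(t,x)+\mathbb{P}f(t,x),\qquad u(0,x)=u_0(x),\qquad x\in\mathbb{R}^d .$$ Suppose that $u$ is smooth enough on $[0,T]$, specifically that there is $\varepsilon\in(0,1)$ such that the following quantities are all finite: $$\|u\|_{L^\infty_TL^\infty},\quad \|\nabla u\|_{L^\infty_TL^\infty},\quad \|\nabla u\|_{L^\infty_TL^2},\quad \|\nabla^2u\|_{L^\infty_TL^{2-\varepsilon}},\quad \|\nabla\,\Xi[u\cdot\nabla u]\|_{L^\infty_TL^\infty},\quad \|\nabla^2\,\Xi[u\cdot\nabla u]\|_{L^\infty_TL^\infty}.$$ Then $$\|u(T,\cdot)\|_{L^2}\le\|u_0\|_{L^2}+\int_0^T\|f(s,\cdot)\|_{L^2}\,ds .$$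
   Context: Notation. For $u=(u_i)_{1\le i\le d}$, $u\cdot\nabla u=\big(\sum_{j=1}^d u_j\,\partial_{x_j}u_i\big)_{1\le i\le d}$. The Leray projector $\mathbb{P}$ (projection onto divergence-free vector fields) is defined, for $\varphi:\mathbb{R}^d\to\mathbb{R}^d$ integrable enough, by $\mathbb{P}\varphi=\varphi+\nabla(-\Delta)^{-1}\nabla\cdot\varphi=:\varphi-\Xi\varphi$, so that $\Xi\varphi=-\nabla(-\Delta)^{-1}\nabla\cdot\varphi$ is the gradient part of the Helmholtz-Hodge decomposition of $\varphi$. Operators act in the space variable only. For $q\in[1,\infty]$, $L^q=L^q(\mathbb{R}^d)$ (for scalar-, vector- or tensor-valued functions), and $\|g\|_{L^\infty_TL^q}=\operatorname{ess\,sup}_{t\in[0,T]}\|g(t,\cdot)\|_{L^q}$. $\nabla$ and $\nabla^2$ denote first and second derivatives in space. The projected equation is the equivalent form of the incompressible Navier-Stokes system $\partial_tu+u\cdot\nabla u=\nu\Delta u-\nabla \mathrm{p}+f$, $\nabla\cdot u=0$, $u(0,\cdot)=u_0$, with unknown velocity $u$ and pressure $\mathrm{p}$. The data $f$ and $u_0$ are assumed regular enough for the equation to be satisfied by $u$ in the classical sense. *)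

(* Defs.v *)
From HB Require Import structures.
From mathcomp Require Import all_boot all_order all_algebra.
From mathcomp Require Import all_classical all_reals all_analysis.
From mathcomp Require Import ess_sup_inf.

Set Implicit Arguments.
Unset Strict Implicit.
Unset Printing Implicit Defensive.

Import Order.TTheory GRing.Theory Num.Theory.
Import numFieldNormedType.Exports.

Local Open Scope classical_set_scope.
Local Open Scope ring_scope.

Lemma sigma_finite_product_measure1 d1 d2 (T1 : measurableType d1)
    (T2 : measurableType d2) (R : realType)
    (m1 : {sigma_finite_measure set T1 -> \bar R})
    (m2 : {sigma_finite_measure set T2 -> \bar R}) :
  sigma_finite [set: T1 * T2] (m1 \x m2)%E.
Proof.
have /sigma_finiteP[F [TF ndF Foo]] := sigma_finiteT m1.
have /sigma_finiteP[G [TG ndG Goo]] := sigma_finiteT m2.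
exists (fun n => F n `*` G n).
  rewrite -setXTT TF TG predeqE => -[x y]; split.
    move=> [/= [n _ Fnx] [k _ Gky]]; exists (maxn n k) => //; split.
    - by move: x Fnx; exact/subsetPset/ndF/leq_maxl.
    - by move: y Gky; exact/subsetPset/ndG/leq_maxr.
  by move=> [n _ []/= ? ?]; split; exists n.
move=> k; have [? ?] := Foo k; have [? ?] := Goo k.
split; first exact: measurableX.
by rewrite product_measure1E// lte_mul_pinfty// ge0_fin_numE.
Qed.

Section lebesgue_tuple.
Context {R : realType}.
Local Notation RT := (measurableTypeR R).

Definition consT n (z : RT * n.-tuple RT) : n.+1.-tuple RT :=
  [tuple of z.1 :: z.2].

Definition unconsT n (t : n.+1.-tuple RT) : RT * n.-tuple RT :=
  (thead t, [tuple of behead t]).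

Lemma consTK n : cancel (@consT n) (@unconsT n).
Proof. by case=> x t; congr (_, _); apply/val_inj. Qed.

Lemma measurable_consT n : measurable_fun [set: RT * n.-tuple RT] (@consT n).
Proof. exact: (measurable_cons measurable_fst measurable_snd). Qed.

Lemma measurable_unconsT n : measurable_fun [set: n.+1.-tuple RT] (@unconsT n).
Proof.
apply/measurable_fun_pairP; split => /=; first exact: (measurable_tnth ord0).
exact: measurable_behead.
Qed.

Section cons_measure.
Context n (m : {sigma_finite_measure set (n.-tuple RT) -> \bar R}).

Definition cons_measure : set (n.+1.-tuple RT) -> \bar R :=
  pushforward (@lebesgue_measure R \x m)%E (@consT n).

Let cons_measure0 : cons_measure set0 = 0%E.
Proof. by rewrite /cons_measure /pushforward preimage_set0 measure0. Qed.

Let cons_measure_ge0 A : (0 <= cons_measure A)%E.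
Proof. by rewrite /cons_measure /pushforward measure_ge0. Qed.

Let cons_measure_sigma_additive : semi_sigma_additive cons_measure.
Proof.
apply: measure_semi_sigma_additive; exact: measurable_consT.
Qed.

HB.instance Definition _ := isMeasure.Build _ _ _ cons_measure
  cons_measure0 cons_measure_ge0 cons_measure_sigma_additive.

Let cons_measure_sigma_finite : sigma_finite [set: n.+1.-tuple RT] cons_measure.
Proof.
have [F FT Fm] := sigma_finite_product_measure1
  (lebesgue_measure : {sigma_finite_measure set RT -> \bar R}) m.
exists (fun k => @unconsT n @^-1` F k) => [|k].
  by rewrite -preimage_bigcup -FT preimage_setT.
have [mFk Fkoo] := Fm k; split.
  by rewrite -[X in measurable X]setTI; exact: measurable_unconsT.
rewrite /cons_measure /pushforward -comp_preimage.
by rewrite (_ : @unconsT n \o @consT n = id) // funeqE; exact: consTK.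
Qed.

HB.instance Definition _ := Measure_isSigmaFinite.Build _ _ _ cons_measure
  cons_measure_sigma_finite.
End cons_measure.

(* [R^(n+1)] carries the image of the product of the Lebesgue measures of [R]
   and [R^n], and [R^0] the unit mass. *)
Fixpoint lebesgue_tuple n : {sigma_finite_measure set (n.-tuple RT) -> \bar R} :=
  if n is n'.+1 then cons_measure (lebesgue_tuple n')
  else dirac [tuple] : {sigma_finite_measure set (0.-tuple RT) -> \bar R}.

End lebesgue_tuple.

Section fields.
Context {R : realType} {d : nat}.
Local Notation V := 'rV[R]_d.

Definition row_of_tuple (t : d.-tuple (measurableTypeR R)) : V :=
  \row_i tnth t i.

Definition partial (j : 'I_d) (g : V -> R) : V -> R :=
  fun x => 'D_(delta_mx 0 j) g x.

Definition component (v : V -> V) (i : 'I_d) : V -> R := fun x => v x 0 i.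

Definition grad (g : V -> R) : V -> V := fun x => \row_j partial j g x.

Definition divergence (v : V -> V) : V -> R := fun x => \sum_i partial i (component v i) x.

Definition laplacian (g : V -> R) : V -> R :=
  fun x => \sum_j partial j (partial j g) x.

Definition vlaplacian (v : V -> V) : V -> V :=
  fun x => \row_i laplacian (component v i) x.

Definition advect (v : V -> V) : V -> V :=
  fun x => \row_i \sum_j v x 0 j * partial j (component v i) x.

Definition nabla (v : V -> V) (ij : 'I_d * 'I_d) : V -> R :=
  partial ij.2 (component v ij.1).

Definition nabla2 (v : V -> V) (ijk : 'I_d * 'I_d * 'I_d) : V -> R :=
  partial ijk.2 (partial ijk.1.2 (component v ijk.1.1)).

Definition C1 (g : V -> R) : Prop :=
  (forall x, differentiable g x) /\ (forall j, continuous (partial j g)).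

Definition C2 (g : V -> R) : Prop := C1 g /\ forall j, C1 (partial j g).

(* [u] is C^1 in time and C^2 in space inside the time interval, and continuous
   up to its endpoints. *)
Definition classical (T : R) (u : R -> V -> V) : Prop :=
  let Q : set (R * V) := `]0, T[ `*` [set: V] in
  [/\ {within `[0, T] `*` [set: V], continuous (fun z : R * V => u z.1 z.2)},
      (forall t x, 0 < t < T -> derivable (u ^~ x) t 1) /\
        {within Q, continuous (fun z : R * V => derive1 (u ^~ z.2) z.1)},
      forall t i, 0 < t < T -> C2 (component (u t) i),
      forall ij, {within Q, continuous (fun z : R * V => nabla (u z.1) ij z.2)} &
      forall ijk,
        {within Q, continuous (fun z : R * V => nabla2 (u z.1) ijk z.2)}].

Definition divergence_free (v : V -> V) : Prop :=
  (forall i x, differentiable (component v i) x) /\ (forall x, divergence v x = 0).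

(* The fields are tensor valued, given by their components, and their values
   are measured in the Euclidean (Frobenius) norm: the norm of the library on
   matrices is the sup norm. *)
Definition normL (q : \bar R) (I : finType) (a : I -> V -> R) : \bar R :=
  Lnorm (lebesgue_tuple d) q
    (fun t => (Num.sqrt (\sum_i a i (row_of_tuple t) ^+ 2))%:E).

Definition normLooL (T : R) (q : \bar R) (I : finType)
    (a : R -> I -> V -> R) : \bar R :=
  ess_sup (mrestr lebesgue_measure (measurable_itv `[0, T]))
    (fun t => normL q (a t)).

(* The solutions of [- laplacian p = g] are taken with square integrable
   gradient, so that p is determined by g up to an additive constant, which
   disappears in the only expression where it is used, [grad p]. *)
Definition inv_opp_laplacian_set (g : V -> R) : set (V -> R) :=
  [set p | [/\ C2 p, (forall x, - laplacian p x = g x) &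
            (normL 2%:E (component (grad p)) < +oo)%E]].

Definition inv_opp_laplacian (g : V -> R) : V -> R :=
  xget (cst 0) (inv_opp_laplacian_set g).

Definition Xi (v : V -> V) : V -> V :=
  fun x => - grad (inv_opp_laplacian (divergence v)) x.

Definition Leray (v : V -> V) : V -> V := fun x => v x - Xi v x.

(* Outside of this domain [Xi] and [Leray] carry no meaning: [partial] and
   [xget] are total and return default values there. *)
Definition Leray_dom (v : V -> V) : Prop :=
  (forall i, C1 (component v i)) /\ inv_opp_laplacian_set (divergence v) !=set0.

(* Joint measurability in time and space; the values of [f] outside of [0, T]
   are irrelevant. *)
Definition measurable_field (T : R) (f : R -> V -> V) : Prop :=
  forall i, measurable_fun
    ((`[0, T] : set (measurableTypeR R)) `*` [set: d.-tuple (measurableTypeR R)])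
    (fun z => component (f z.1) i (row_of_tuple z.2)).

End fields.

(* Main.v *)
(** An energy estimate with compact cutoffs. For [bump r], a [C^1] cutoff
    supported in the ball of radius [r], the time derivative of
    [int (bump r) |u|^2] is computed by differentiating under the integral and
    integrating by parts. In it the viscous, transport and forcing terms are
    elementary, and the field [w = P (u . grad u - f)] is bounded in [L^2] by
    [|u . grad u - f|_2 <= M |grad u|_2 + |f|_2], because the Leray projection
    is a contraction. A first pass, with these crude bounds and [r] going to
    infinity, shows that [u t] is square integrable. In a second pass, the
    transport term vanishes in the limit and the pairing of [u] with the
    gradient part of [w] vanishes too, which leaves [|f|_2]. Everything is
    integrated for [sqrt (int (bump r) |u|^2 + eta)], and [eta] then goes to [0].

    Both passes use that a square integrable divergence-free field [v] is
    orthogonal to a square integrable gradient [grad p], where nothing is known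
    about the growth of [p] itself. Translate [p] by [s e]: up to an error
    [O(s / r)] due to the cutoff, the pairing does not depend on [s]; and it
    tends to [0] as [s] goes to infinity, since then the masses of [v] and of
    the translate of [grad p] lie in different half spaces. *)

(* Besides making [u t] square integrable, the first pass supplies the dominating function of the
   second. The pairing of [u] with the pressure gradient tends to 0 at almost every time, but at no
   controlled rate; the constant of the first pass, uniform in the radius and in time, is what lets
   the limit through the time integral. Up to that vanishing error, each rate is bounded by a
   multiple of the square root of the local energy, so the quantity followed is [sqrt (E + eta)]:
   division by twice this root removes [u] from the bound, and [eta] keeps the root differentiable
   where the energy vanishes. The norm of [f] is merely measurable in time and the bounds hold
   almost everywhere. Hence no differential inequality is integrated. The fundamental theorem of
   calculus is applied to the derivative itself, which is continuous, and the part of it not covered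
   by the norm of [f] is collected in [excess]. *)
From HB Require Import structures.
From mathcomp Require Import all_boot all_order all_algebra.
From mathcomp Require Import all_classical all_reals all_analysis.
From mathcomp Require Import measurable_realfun ess_sup_inf ring lra.
Require Import Defs.

Set Implicit Arguments.
Unset Strict Implicit.
Unset Printing Implicit Defensive.

Import Order.TTheory GRing.Theory Num.Theory.
Import numFieldNormedType.Exports.

Local Open Scope classical_set_scope.
Local Open Scope ring_scope.

(** * Lebesgue measure on row vectors *)

Section measure.
Context {R : realType}.
Local Notation RT := (measurableTypeR R).

Lemma normr_row_le n (x : 'rV[R]_n) r : 0 <= r ->
  (`|x| <= r) <-> (forall i, `|x 0 i| <= r).
Proof.
move=> r0; rewrite [`|x|]/Num.norm/= mx_normrE; split=> [+ i|h].
  by move/bigmax_leP => [_ /(_ (0, i) isT)].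
by apply/bigmax_leP; split => //= -[a i] _; rewrite ord1; exact: h.
Qed.

Lemma normr_row_lt n (x : 'rV[R]_n) r : 0 < r ->
  (`|x| < r) <-> (forall i, `|x 0 i| < r).
Proof.
move=> r0; rewrite [`|x|]/Num.norm/= mx_normrE; split=> [+ i|h].
  by move/bigmax_ltP => [_ /(_ (0, i) isT)].
by apply/bigmax_ltP; split => //= -[a i] _; rewrite ord1; exact: h.
Qed.

Lemma measurable_preimage_ball n (c : 'rV[R]_n) r :
  measurable [set t : n.-tuple RT | ball c r (row_of_tuple t)].
Proof.
have [r0|r0] := ltP 0 r; last first.
  rewrite [X in measurable X](_ : _ = set0)//; apply/seteqP; split => // t /=.
  by rewrite -ball_normE /ball_/= ltNge (le_trans r0).
rewrite [X in measurable X](_ : _ = \bigcap_(i in [set: 'I_n])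
    [set t | `|c 0 i - tnth t i| < r]).
  apply: fin_bigcap_measurable => // i _.
  rewrite (_ : [set _ | _] =
    (fun t : n.-tuple RT => tnth t i) @^-1` (ball (c 0 i) r)); last first.
    by apply/seteqP; split=> t /=; rewrite -ball_normE.
  rewrite -[X in measurable X]setTI.
  apply: measurable_tnth => //; apply: open_measurable; exact: ball_open.
apply/seteqP; split=> t /=; rewrite -ball_normE /ball_/= => h.
  by move=> i _; have /(_ r0)/(_ i) := (normr_row_lt _ _).1 h; rewrite !mxE.
by apply/(normr_row_lt _ r0) => i; have := h i I; rewrite !mxE.
Qed.

Lemma rat_row_approx n (x : 'rV[R]_n) (e : R) : 0 < e ->
  exists q : 'rV[rat]_n, `|x - map_mx ratr q| < e.
Proof.
move=> e0.
have /choice[q hq] : forall i, exists q : rat, `|x 0 i - ratr q| < e.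
  move=> i; have /rat_in_itvoo[q] : x 0 i - e < x 0 i + e by lra.
  by rewrite in_itv/= => /andP[h1 h2]; exists q; rewrite ltr_distlC; lra.
exists (\row_i q i); apply/(normr_row_lt _ e0) => i; rewrite !mxE; exact: hq.
Qed.

(** The sigma-algebra on tuples comes from the coordinates, the topology on row vectors from the sup
    norm. They meet because an open set is a countable union of balls with rational centre and
    radius [1 / (k + 1)], and such balls are boxes. *)
Lemma measurable_preimage_open n (O : set 'rV[R]_n) : open O ->
  measurable [set t : n.-tuple RT | O (row_of_tuple t)].
Proof.
move=> oO.
pose B (p : 'rV[rat]_n * nat) : set 'rV[R]_n :=
  ball (map_mx ratr p.1 : 'rV[R]_n) p.2.+1%:R^-1.
rewrite (_ : [set _ | _] = \bigcup_p
    [set t : n.-tuple RT | B p `<=` O /\ B p (row_of_tuple t)]); last first.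
  apply/seteqP; split=> [t /= Ot|t [p _ [BpO Bpt]]]; last exact: BpO.
  have /nbhs_ballP[e /= e0 eO] := open_nbhs_nbhs (conj oO Ot).
  have [k _ hk] := near_infty_natSinv_lt (PosNum (divr_gt0 e0 (ltr0Sn R 1))).
  have hk' : k.+1%:R^-1 < e / 2 by exact: (hk k (leqnn k)).
  have k0 : 0 < k.+1%:R^-1 :> R by rewrite invr_gt0.
  have [q hq] := rat_row_approx (row_of_tuple t) k0.
  exists (q, k) => //=; split; last first.
    by rewrite /B /= -ball_normE /ball_/= distrC.
  move=> y /=; rewrite /B -ball_normE /ball_/= => hy; apply: eO.
  rewrite -ball_normE /ball_/=.
  rewrite (_ : _ - y = (row_of_tuple t - map_mx ratr q) + (map_mx ratr q - y)).
    by rewrite (le_lt_trans (ler_normD _ _))// (lt_trans (ltrD hq hy))// (lt_le_trans (ltrD hk' hk'))// -splitr.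
  by rewrite addrA subrK.
apply: countable_bigcupT_measurable => [|p]; first exact: countableP.
have [BpO|nBpO] := pselect (B p `<=` O).
  rewrite [X in measurable X](_ : _ = [set t | B p (row_of_tuple t)]).
    exact: measurable_preimage_ball.
  by apply/seteqP; split=> t /= => [[]|].
rewrite [X in measurable X](_ : _ = set0)//.
by apply/seteqP; split=> t //= [].
Qed.

Lemma measurable_continuous_row n (g : 'rV[R]_n -> R) : continuous g ->
  measurable_fun [set: n.-tuple RT] (g \o row_of_tuple).
Proof.
move=> cg; apply: (measurability _ (RGenOpens.measurableE R)) => /=.
move=> _ [_ [a [b ->] <-]]; rewrite setTI.
apply: (@measurable_preimage_open _ (g @^-1` `]a, b[)).
by move/continuousP : cg; apply; exact: interval_open.
Qed.

Lemma measurable_box n (r : R) :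
  measurable [set t : n.-tuple RT | forall i, tnth t i \in `[-r, r]].
Proof.
rewrite [X in measurable X](_ : _ = \bigcap_(i in [set: 'I_n])
    (fun t : n.-tuple RT => tnth t i) @^-1` `[-r, r]).
  apply: fin_bigcap_measurable => // i _.
  by rewrite -[X in measurable X]setTI; exact: measurable_tnth.
by apply/seteqP; split=> t /= h i; [move=> _|]; exact: h.
Qed.

Lemma lebesgue_tuple_box_lty n (r : R) :
  (lebesgue_tuple n [set t : n.-tuple RT | forall i, (tnth t i \in `[-r, r])%R] < +oo)%E.
Proof.
elim: n => [|n IH].
  by rewrite /= diracE; case: (_ \in _); rewrite ltry.
rewrite /= /cons_measure /pushforward.
rewrite (_ : consT (n:=n) @^-1` _ = `[-r, r]%classic `*`
    [set t : n.-tuple RT | forall i, tnth t i \in `[-r, r]]); last first.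
  apply/seteqP; split=> -[x t] /=.
    move=> h; split; first by have := h ord0; rewrite tnth0.
    by move=> i; have := h (lift ord0 i); rewrite tnthS.
  move=> [hx ht] i; case: (unliftP ord0 i) => [j|] -> /=; last by rewrite tnth0.
  by rewrite tnthS.
rewrite product_measure1E//; last exact: measurable_box.
apply: lte_mul_pinfty => //.
  by rewrite ge0_fin_numE// [X in (X < _)%E]lebesgue_measure_itv/=; case: ifP => _; rewrite ?ltry.
Qed.

Definition shiftT n (v : 'rV[R]_n) (t : n.-tuple RT) : n.-tuple RT :=
  [tuple tnth t i + v 0 i | i < n].

Lemma row_shiftT n (v : 'rV[R]_n) t :
  row_of_tuple (shiftT v t) = row_of_tuple t + v.
Proof. by apply/rowP => i; rewrite !mxE tnth_mktuple. Qed.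

Lemma measurable_shiftT n (v : 'rV[R]_n) : measurable_fun setT (shiftT v).
Proof.
apply/measurable_fun_tnthP => i.
rewrite (_ : _ \o _ = fun t => tnth t i + v 0 i); last first.
  by apply/funext => t /=; rewrite tnth_mktuple.
by apply: measurable_funD => //; exact: measurable_tnth.
Qed.

Lemma lebesgue_measure_shift (a : R) (A : set R) : measurable A ->
  pushforward (@lebesgue_measure R)
    ((fun x => x + a) : RT -> RT) A = lebesgue_measure A.
Proof.
have mf : measurable_fun [set: RT] ((fun x => x + a) : RT -> RT).
  exact: measurable_funD.
move=> mA; apply/esym/lebesgue_measure_unique => //= _ [[b c]] _ <-.
rewrite /pushforward (_ : _ @^-1` _ = `]b - a, c - a]%classic).
  rewrite !lebesgue_measure_itv/= !lte_fin ltrD2r; case: ifPn => // _.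
  by rewrite -!EFinB; congr (_%:E); ring.
by apply/seteqP; split=> x /=; rewrite !in_itv/= ltrBlDr lerBrDr.
Qed.

(** By induction on the dimension: the induction hypothesis translates each section, and invariance
    on the line translates the first coordinate. *)
Lemma lebesgue_tuple_shift n (v : 'rV[R]_n) A : measurable A ->
  lebesgue_tuple n (shiftT v @^-1` A) = lebesgue_tuple n A.
Proof.
elim: n v A => [|n IH] v A mA.
  by rewrite (_ : _ @^-1` _ = A)//; apply/seteqP; split=> t;
    rewrite /= (tuple0 t) (tuple0 (shiftT _ _)).
rewrite /= /cons_measure /pushforward /product_measure1.
pose B := consT (n:=n) @^-1` A.
have mB : measurable B.
  by rewrite -[X in measurable X]setTI; exact: measurable_consT.
pose G x := lebesgue_tuple n (xsection B x).
transitivity (\int[lebesgue_measure]_(x in [set: RT]) (G \o (fun x => (x + v 0 0)%R)) x)%E.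
  apply: eq_integral => x _ /=; rewrite /G -(IH (\row_i v 0 (lift ord0 i))); last first.
    exact: measurable_xsection.
  congr (lebesgue_tuple n _); apply/seteqP; split=> t; rewrite /xsection/= !inE /B/=;
  suff -> : shiftT v (consT (x, t)) = consT (x + v 0 0, shiftT (\row_i v 0 (lift ord0 i)) t) by [].
    apply: eq_from_tnth => i; rewrite tnth_mktuple.
    by case: (unliftP ord0 i) => [j|] ->; rewrite ?tnthS ?tnth0// tnth_mktuple mxE.
  apply: eq_from_tnth => i; rewrite tnth_mktuple.
  by case: (unliftP ord0 i) => [j|] ->; rewrite ?tnthS ?tnth0// tnth_mktuple mxE.
have mG : measurable_fun setT G by exact: measurable_fun_xsection.
rewrite -[in LHS](preimage_setT (fun x : RT => (x + v 0 0 : RT))).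
rewrite -ge0_integral_pushforward//.
- apply: eq_measure_integral => /= [|mf C mC _]; first exact: measurable_funD.
  exact: (lebesgue_measure_shift (v 0 0) mC).
- exact: measurable_funD.
Qed.

End measure.

(** * Integration of functions of a row vector *)

Section vint.
Context {R : realType} {d : nat}.
Local Notation RT := (measurableTypeR R).
Local Notation V := 'rV[R]_d.
Local Notation mu := (@lebesgue_tuple R d).
Implicit Types (g h : V -> R) (r : R).

(** The value is the [fine] of an extended integral, hence 0 when that integral is infinite; bounds
    on [vint] are therefore accompanied by [vintegrable]. *)
Definition vint (g : V -> R) : R := \int[mu]_t g (row_of_tuple t).

Definition vintegrable (g : V -> R) : Prop :=
  mu.-integrable setT (fun t => (g (row_of_tuple t))%:E).

(** The norm is the sup norm, so the closed ball of radius [r] is the box [vbox r]. *)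
Definition vanishes_outside r g := forall x, r < `|x| -> g x = 0.

Definition vbox r : set (d.-tuple RT) :=
  [set t | forall i, (tnth t i \in `[-r, r])%R].

Lemma compact_normr_le r : compact [set x : V | `|x| <= r].
Proof.
have [r0|r0] := leP 0 r; last first.
  rewrite (_ : [set _ | _] = set0); first exact: compact0.
  by apply/seteqP; split=> x //=; rewrite leNgt (lt_le_trans r0).
rewrite (_ : [set _ | _] = [set v : V | forall i, `[-r, r]%classic (v ord0 i)]).
  apply: (@rV_compact _ _ (fun _ => `[-r, r]%classic)) => i.
  exact: segment_compact.
apply/seteqP; split=> x /=.
  by move=> /(normr_row_le _ r0) h i; rewrite in_itv/= -ler_norml.
by move=> h; apply/(normr_row_le _ r0) => i; have := h i; rewrite in_itv/= -ler_norml.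
Qed.

Lemma bounded_slab (a b r : R) (F : R -> V -> R) :
  (forall t x, t \in `[a, b] -> {for (t, x), continuous (fun z : R * V => F z.1 z.2)}) ->
  exists2 M, 0 <= M & forall t x, t \in `[a, b] -> `|x| <= r -> `|F t x| <= M.
Proof.
move=> cF.
have cK : compact (`[a, b]%classic `*` [set x : V | `|x| <= r]).
  by apply: compact_setX; [exact: segment_compact|exact: compact_normr_le].
have /compact_bounded[M [_ hM]] : compact ((fun z : R * V => F z.1 z.2) @`
    (`[a, b]%classic `*` [set x : V | `|x| <= r])).
  apply: continuous_compact => //; apply: continuous_in_subspaceT => -[t x].
  by rewrite inE/= => -[tab _]; exact: cF.
exists (`|M| + 1) => [|t x tab xr]; first by rewrite addr_ge0.
apply: (hM (`|M| + 1)); first by rewrite (le_lt_trans (ler_norm _))// ltrDl.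
by exists (t, x).
Qed.

Lemma vbox_normr r (t : d.-tuple RT) : 0 <= r -> vbox r t <-> `|row_of_tuple t| <= r.
Proof.
move=> r0; split.
  by move=> h; apply/(normr_row_le _ r0) => i; have := h i; rewrite mxE in_itv/= -ler_norml.
by move=> /(normr_row_le _ r0) h i; have := h i; rewrite mxE in_itv/= -ler_norml.
Qed.

Lemma vintegrable_box (M r : R) :
  mu.-integrable setT (EFin \o (fun t => M * \1_(vbox r) t)).
Proof.
rewrite (_ : _ \o _ = fun t => (M%:E * (\1_(vbox r) t)%:E)%E); last first.
  by apply/funext => t /=; rewrite EFinM.
apply: integrableZl => //; apply/integrableP; split.
  by apply/measurable_EFinP/measurable_indic; exact: measurable_box.
under eq_integral do rewrite gee0_abs ?lee_fin//.
rewrite integral_indic//; last exact: measurable_box.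
by rewrite setIT; exact: lebesgue_tuple_box_lty.
Qed.

Lemma normr_le_box M r g : 0 <= M -> vanishes_outside r g ->
  (forall x, `|x| <= r -> `|g x| <= M) ->
  forall t, `|g (row_of_tuple t)| <= M * \1_(vbox `|r|) t.
Proof.
move=> M0 sg gM t.
have [rt|rt] := ltP r `|row_of_tuple t|.
  by rewrite sg// normr0 mulr_ge0// indicE ler0n.
rewrite indicE mem_set ?mulr1; first exact: gM.
by apply/vbox_normr => //; rewrite (le_trans rt)// ler_norm.
Qed.

Lemma vintegrable_compact r g : continuous g -> vanishes_outside r g ->
  vintegrable g.
Proof.
move=> cg sg.
(* A function of [x] alone is treated as constant in time over the degenerate interval [[0, 0]]. *)
have [|M M0 hM] := @bounded_slab 0 0 r (fun _ => g).
  move=> t x _; apply: (@continuous_comp _ _ _ (snd : R * V -> V) g).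
    exact: cvg_snd.
  exact: cg.
apply: (le_integrable _ _ _ (vintegrable_box M `|r|)) => //.
- by apply/measurable_EFinP; exact: (measurable_continuous_row cg).
- move=> t _ /=; rewrite lee_fin [leRHS]ger0_norm ?mulr_ge0//.
  apply: (normr_le_box M0 sg).
  by move=> x xr; apply: (hM 0) => //; rewrite in_itv/= lexx.
Qed.

Lemma ge0_integral_shiftT (v : V) (f : d.-tuple RT -> \bar R) :
  measurable_fun setT f -> (forall t, 0 <= f t)%E ->
  (\int[mu]_t f (shiftT v t) = \int[mu]_t f t)%E.
Proof.
move=> mf f0; have mv := measurable_shiftT v.
transitivity (\int[pushforward mu (shiftT v)]_t f t)%E.
  by rewrite (ge0_integral_pushforward mv mu measurableT).
by apply: (eq_measure_integral mu) => A mA _; exact: lebesgue_tuple_shift.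
Qed.

Lemma vintegrable_shift (v : V) g : vintegrable g -> vintegrable (fun x => g (x + v)).
Proof.
have mv := measurable_shiftT v.
move=> /integrableP[mg ig]; apply/integrableP; split.
  under eq_fun do rewrite -row_shiftT.
  exact: (measurableT_comp mg mv).
under eq_integral do rewrite -row_shiftT.
rewrite (ge0_integral_shiftT v (f := fun t => `|(g (row_of_tuple t))%:E|%E))//.
exact: measurableT_comp.
Qed.

Lemma vint_shift (v : V) g : vintegrable g -> vint (fun x => g (x + v)) = vint g.
Proof.
have mv := measurable_shiftT v.
move=> ig; rewrite /vint /Rintegral; congr fine.
under eq_integral do rewrite -row_shiftT.
have igv : mu.-integrable (shiftT v @^-1` setT)
    ((fun t => (g (row_of_tuple t))%:E) \o shiftT v).
  rewrite preimage_setT; have := vintegrable_shift v ig; rewrite /vintegrable.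
  by under [X in integrable _ _ X -> _]eq_fun do rewrite -row_shiftT.
rewrite -[LHS](integral_pushforward mv _ igv)//; last exact: measurable_int ig.
by apply: (eq_measure_integral mu) => A mA _; exact: lebesgue_tuple_shift.
Qed.

Lemma itvoo_nbhs (a b t : R) : t \in `]a, b[ ->
  exists a' b', [/\ a < a', b' < b & t \in `]a', b'[].
Proof.
rewrite in_itv/= => /andP[at_ tb]; exists ((a + t) / 2), ((t + b) / 2).
by rewrite in_itv/=; split; [lra|lra|apply/andP; split; lra].
Qed.

Lemma joint_continuous_r (F : R -> V -> R) t x :
  {for (t, x), continuous (fun z : R * V => F z.1 z.2)} -> {for x, continuous (F t)}.
Proof.
move=> c; apply: (@continuous_comp _ _ _ (fun y : V => (t, y)) (fun z => F z.1 z.2)) => //.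
exact: (@cvg_pair _ _ _ (nbhs x) (nbhs t) (nbhs x) _ _ _ (fun _ => t) id (cvg_cst t) cvg_id).
Qed.

Lemma joint_continuous_l (F : R -> V -> R) t x :
  {for (t, x), continuous (fun z : R * V => F z.1 z.2)} -> {for t, continuous (F ^~ x)}.
Proof.
move=> c; apply: (@continuous_comp _ _ _ (fun s : R => (s, x)) (fun z => F z.1 z.2)) => //.
exact: (@cvg_pair _ _ _ (nbhs t) (nbhs t) (nbhs x) _ _ _ id (fun _ => x) cvg_id (cvg_cst x)).
Qed.

Lemma vint_continuous (a b r : R) (F : R -> V -> R) :
  (forall t x, t \in `]a, b[ -> {for (t, x), continuous (fun z : R * V => F z.1 z.2)}) ->
  (forall t, t \in `]a, b[ -> vanishes_outside r (F t)) ->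
  forall t, t \in `]a, b[ -> {for t, continuous (fun s => vint (F s))}.
Proof.
move=> cF sF t tab.
(* A smaller closed interval makes the slab compact, so that a constant times the indicator of a box
   dominates. *)
have [a' [b' [aa' bb' tab']]] := itvoo_nbhs tab.
have sub s : s \in `[a', b'] -> s \in `]a, b[.
  by rewrite !in_itv/= => /andP[? ?]; apply/andP; split; lra.
have subo s : s \in `]a', b'[ -> s \in `[a', b'] by exact: subset_itv_oo_cc.
have [|M M0 hM] := @bounded_slab a' b' r F.
  by move=> s x /sub; exact: cF.
apply: (@continuity_under_integral R _ _ mu (fun s y => F s (row_of_tuple y)) setT
  measurableT a' b' _ _ (fun t => M * \1_(vbox `|r|) t)) => //.
- move=> s /subo/sub sab; apply: (vintegrable_compact _ (sF _ sab)) => x.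
  exact/joint_continuous_r/cF.
- apply: aeW => y _ s; rewrite inE => /subo/sub sab.
  exact: (joint_continuous_l (cF _ _ sab)).
- exact: vintegrable_box.
- move=> s /subo sab; apply: aeW => y _.
  by apply: (normr_le_box M0 (sF _ (sub _ sab))) => x xr; exact: hM.
- by rewrite inE.
Qed.

Lemma vint_derive (a b r : R) (F G : R -> V -> R) :
  (forall t, t \in `]a, b[ -> continuous (F t)) ->
  (forall t, t \in `]a, b[ -> vanishes_outside r (F t)) ->
  (forall t x, t \in `]a, b[ -> is_derive t 1 (F ^~ x) (G t x)) ->
  (forall t x, t \in `]a, b[ -> {for (t, x), continuous (fun z : R * V => G z.1 z.2)}) ->
  forall t, t \in `]a, b[ ->
    is_derive t 1 (fun s => vint (F s)) (vint (G t)) /\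
    {for t, continuous (fun s => vint (G s))}.
Proof.
move=> cF sF dF cG.
(* [G] inherits the support: outside the ball, [F] is zero at all nearby times. *)
have sG t : t \in `]a, b[ -> vanishes_outside r (G t).
  move=> tab x rx; have dFx := dF t x tab.
  rewrite -(@derive_val _ _ _ _ _ _ _ dFx).
  transitivity ('D_1 (cst 0 : R -> R) t); last by rewrite derive_cst.
  apply: near_eq_derive => //.
  have := near_in_itvoo tab; apply: filterS => s sab.
  by rewrite sF.
move=> t tab; split; last exact: (vint_continuous cG sG tab).
have [a' [b' [aa' bb' tab']]] := itvoo_nbhs tab.
have sub s : s \in `[a', b'] -> s \in `]a, b[.
  by rewrite !in_itv/= => /andP[? ?]; apply/andP; split; lra.
have subo s : s \in `]a', b'[ -> s \in `[a', b'] by exact: subset_itv_oo_cc.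
have [|M M0 hM] := @bounded_slab a' b' r G.
  by move=> s x /sub; exact: cG.
have intF s : `]a', b'[%classic s -> mu.-integrable setT
    (EFin \o (fun y => F s (row_of_tuple y))).
  move=> /subo/sub sab; exact: (vintegrable_compact (cF _ sab) (sF _ sab)).
have derF s y : `]a', b'[%classic s -> [set: d.-tuple RT] y ->
    derivable ((fun s y => F s (row_of_tuple y)) ^~ y) s 1.
  by move=> /subo/sub sab _; have := dF s (row_of_tuple y) sab; case.
have GE s y : s \in `]a', b'[ ->
    partial1of2 (fun s y => F s (row_of_tuple y)) s y = G s (row_of_tuple y).
  move=> /subo/sub sab; rewrite partial1of2E.
  by have dFx := dF s (row_of_tuple y) sab; rewrite derive_val.
have Gub s y : `]a', b'[%classic s -> [set: d.-tuple RT] y ->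
    `|partial1of2 (fun s y => F s (row_of_tuple y)) s y| <= M * \1_(vbox `|r|) y.
  move=> /= sab _; rewrite GE//.
  by apply: (normr_le_box M0 (sG _ (sub _ (subo _ sab)))) => x xr; apply: hM => //; exact: subo.
have g0 y : 0 <= M * \1_(vbox `|r|) y by rewrite mulr_ge0// indicE ler0n.
apply: DeriveDef.
  exact: (@derivable_under_integral _ _ _ mu _ setT measurableT t a' b' tab'
    intF derF _ g0 (vintegrable_box M `|r|) Gub).
rewrite -derive1E.
rewrite (@differentiation_under_integral _ _ _ mu _ setT measurableT t a' b' tab'
    intF derF _ g0 (vintegrable_box M `|r|) Gub).
by apply: eq_Rintegral => y _; rewrite GE.
Qed.

End vint.

(** * Domination, Cauchy-Schwarz and integrals of derivatives *)

Section vint_theory.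
Context {R : realType} {d : nat}.
Local Notation RT := (measurableTypeR R).
Local Notation V := 'rV[R]_d.
Local Notation mu := (@lebesgue_tuple R d).
Implicit Types (f g h : V -> R) (r : R).

Definition vmeasurable g :=
  measurable_fun [set: d.-tuple RT] (g \o row_of_tuple).

Lemma continuous_vmeasurable g : continuous g -> vmeasurable g.
Proof. exact: measurable_continuous_row. Qed.

Lemma vintegrable_measurable g : vintegrable g -> vmeasurable g.
Proof. by move=> /integrableP[/measurable_EFinP]. Qed.

Lemma vintegrable_le g h : vmeasurable g -> vintegrable h ->
  (forall x, `|g x| <= h x) -> vintegrable g.
Proof.
move=> mg ih gh; apply: (le_integrable _ _ _ ih) => //; first exact/measurable_EFinP.
by move=> t _ /=; rewrite lee_fin (le_trans (gh _))// ler_norm.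
Qed.

Lemma vintegrableD g h : vintegrable g -> vintegrable h ->
  vintegrable (fun x => g x + h x).
Proof. by move=> ig ih; exact: (integrableD _ ig ih). Qed.

Lemma vintegrableB g h : vintegrable g -> vintegrable h ->
  vintegrable (fun x => g x - h x).
Proof. by move=> ig ih; exact: (integrableB _ ig ih). Qed.

Lemma vintegrableZ (k : R) g : vintegrable g -> vintegrable (fun x => k * g x).
Proof. by move=> ig; exact: (integrableZl _ k ig). Qed.

Lemma vintegrable0 : vintegrable (fun _ : V => 0 : R).
Proof. exact: integrable0. Qed.

Lemma vintD g h : vintegrable g -> vintegrable h ->
  vint (fun x => g x + h x) = vint g + vint h.
Proof. by move=> ig ih; exact: (RintegralD measurableT ig ih). Qed.

Lemma vintB g h : vintegrable g -> vintegrable h ->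
  vint (fun x => g x - h x) = vint g - vint h.
Proof. by move=> ig ih; exact: (RintegralB measurableT ig ih). Qed.

Lemma vintZ (k : R) g : vintegrable g -> vint (fun x => k * g x) = k * vint g.
Proof. by move=> ig; exact: (RintegralZl _ measurableT ig). Qed.

Lemma eq_vint g h : g =1 h -> vint g = vint h.
Proof. by move=> gh; apply: eq_Rintegral => t _; rewrite gh. Qed.

Lemma vint0 : vint (fun _ : V => 0 : R) = 0.
Proof. by rewrite /vint Rintegral_cst// mul0r. Qed.

Lemma vint_sum (I : finType) (g : I -> V -> R) :
  (forall i, vintegrable (g i)) ->
  vint (fun x => \sum_i g i x) = \sum_i vint (g i).
Proof.
move=> ig; rewrite /index_enum; move: (Finite.enum I) => s.
have : vintegrable (fun x => \sum_(i <- s) g i x) /\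
   vint (fun x => \sum_(i <- s) g i x) = \sum_(i <- s) vint (g i).
  elim: s => [|i s [IH1 IH2]].
    split; first by under eq_fun do rewrite big_nil; exact: vintegrable0.
    by rewrite big_nil -[RHS]vint0; apply: eq_vint => x; rewrite big_nil.
  split; first by under eq_fun do rewrite big_cons; exact: vintegrableD.
  rewrite big_cons -IH2 -vintD//; apply: eq_vint => x.
  by rewrite big_cons.
by case.
Qed.

Lemma le_vint g h : vintegrable g -> vintegrable h -> (forall x, g x <= h x) ->
  vint g <= vint h.
Proof. by move=> ig ih gh; apply: (le_Rintegral measurableT ig ih) => t _. Qed.

Lemma vint_ge0 g : (forall x, 0 <= g x) -> 0 <= vint g.
Proof. by move=> g0; apply: Rintegral_ge0. Qed.

Lemma le_norm_vint g : vintegrable g -> `|vint g| <= vint (fun x => `|g x|).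
Proof. by move=> ig; exact: (le_normr_Rintegral measurableT ig). Qed.

Lemma vintegrable_norm g : vintegrable g -> vintegrable (fun x => `|g x|).
Proof. by move=> ig; exact: (integrable_norm ig). Qed.

Lemma vint_dominated (f : nat -> V -> R) g h :
  (forall n, vmeasurable (f n)) -> vintegrable h ->
  (forall n x, `|f n x| <= h x) ->
  (forall x, f ^~ x @ \oo --> g x) ->
  vintegrable g /\ (fun n => vint (f n)) @ \oo --> vint g.
Proof.
move=> mf ih fh fg.
have mf' n : measurable_fun setT (fun t => (f n (row_of_tuple t))%:E).
  by apply/measurable_EFinP; exact: mf.
have mg' : measurable_fun setT (fun t => (g (row_of_tuple t))%:E).
  apply: (emeasurable_fun_cvg (fun n t => (f n (row_of_tuple t))%:E)) => // t _.
  by apply: cvg_EFin; [exact: nearW|exact: fg].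
have fg' : {ae mu, forall t, setT t ->
    (fun n => (f n (row_of_tuple t))%:E) @ \oo --> (g (row_of_tuple t))%:E}.
  by apply: aeW => t _; apply: cvg_EFin; [exact: nearW|exact: fg].
have fh' : {ae mu, forall t n, setT t ->
    (`|(f n (row_of_tuple t))%:E| <= (h (row_of_tuple t))%:E)%E}.
  by apply: aeW => t n _; rewrite lee_fin.
have [ig _ cvgf] := dominated_convergence measurableT mf' mg' fg' ih fh'.
split => //; apply: fine_cvg; rewrite fineK; first exact: cvgf.
exact: integrable_fin_num ig.
Qed.

Lemma quadratic_ge0 (a b c : R) :
  (forall l, 0 <= l ^+ 2 * a - l * (2 * c) + b) -> 0 <= a -> c ^+ 2 <= a * b.
Proof.
move=> h; rewrite le_eqVlt => /predU1P[a0|a0]; last first.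
  (* The minimizer of the quadratic. *)
  have := h (c / a).
  rewrite (_ : _ + b = (a * b - c ^+ 2) / a); last by field; rewrite gt_eqF.
  by rewrite pmulr_lge0 ?invr_gt0// subr_ge0.
rewrite -a0 mul0r; have [->|c0] := eqVneq c 0; first by rewrite expr0n.
(* For [a = 0] the expression is affine in [l], and this [l] gives it the value -1. *)
have := h ((b + 1) / (2 * c)); rewrite -a0 mulr0 sub0r divfK; last by rewrite mulf_neq0.
lra.
Qed.

(** The pointwise hypothesis makes [l^2 g - 2 l c + h] nonnegative for every [l]; integrating it
    gives a quadratic in [l] whose discriminant is the claim. The form with [g] and [h], rather than
    squares, leaves the choice of where a cutoff weight goes. *)
Lemma vint_Cauchy_Schwarz c g h : vmeasurable c ->
  vintegrable g -> vintegrable h -> (forall x, 0 <= g x) -> (forall x, 0 <= h x) ->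
  (forall x, c x ^+ 2 <= g x * h x) ->
  vintegrable c /\ vint c ^+ 2 <= vint g * vint h.
Proof.
move=> mc ig ih g0 h0 cgh.
have pt x l : 0 <= l ^+ 2 * g x - l * (2 * c x) + h x.
  have := g0 x; rewrite le_eqVlt => /predU1P[gx|gx].
    have := cgh x; rewrite -gx mul0r real_exprn_even_le0//= => /eqP ->.
    by rewrite !mulr0 subr0 add0r.
  rewrite -(pmulr_rge0 _ gx).
  rewrite (_ : g x * _ = (l * g x - c x) ^+ 2 + (g x * h x - c x ^+ 2)); last by ring.
  by rewrite addr_ge0 ?sqr_ge0// subr_ge0.
have ic : vintegrable c.
  apply: (vintegrable_le mc (vintegrableD ig ih)) => x.
  (* The values 1 and -1 of [l] bound [2 |c|] by [g + h], whence integrability. *)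
  have := pt x 1; have := pt x (-1); have := g0 x; have := h0 x.
  by rewrite ler_norml => *; apply/andP; split; lra.
split => //; apply: quadratic_ge0; last exact: vint_ge0.
move=> l; rewrite -!vintZ//; last exact: vintegrableZ.
rewrite -vintB; [|exact: vintegrableZ|by do 2 apply: vintegrableZ].
rewrite -vintD//; last by apply: vintegrableB; do ?apply: vintegrableZ.
exact: vint_ge0.
Qed.

Lemma is_derive_line (F : V -> R) (x v : V) (s : R) :
  derivable F (x + s *: v) v ->
  is_derive s 1 (fun s => F (x + s *: v)) ('D_v F (x + s *: v)).
Proof.
move=> dF.
have E : (fun h : R => h^-1 *: (F (x + (h *: (1 : R) + s) *: v) - F (x + s *: v))) =
    (fun h : R => h^-1 *: (F (h *: v + (x + s *: v)) - F (x + s *: v))).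
  apply/funext => h; congr (_ *: (F _ - _)).
  by rewrite [h *: 1]mulr1 scalerDl addrCA.
apply: DeriveDef.
  by rewrite /derivable/= E; exact: dF.
by rewrite /derive/= E.
Qed.

(** The integral of [F (x + s e_j)] does not depend on [s], by translation invariance, and its
    derivative at [s = 0] is the integral of the partial derivative. For [|s| < 1] the translates
    share the support radius [r + |e|]. *)
Lemma vint_partial (r : R) (j : 'I_d) (F : V -> R) :
  continuous F -> vanishes_outside r F ->
  (forall x, derivable F x (delta_mx 0 j)) -> continuous (partial j F) ->
  vint (partial j F) = 0.
Proof.
move=> cF sF dF cpF; pose e : V := delta_mx 0 j.
have cshift s : continuous (fun x : V => x + s *: e).
  by move=> x; exact: (cvgD cvg_id (cvg_cst _)).
have [|||||D _] := @vint_derive R d (-1) 1 (r + `|e|) (fun s x => F (x + s *: e))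
   (fun s x => partial j F (x + s *: e)) _ _ _ _ 0.
- by move=> t _ x; apply: continuous_comp; [exact: cshift|exact: cF].
- move=> t t1 x rx; apply: sF; move: t1; rewrite in_itv/= => t1.
  rewrite -(ltrD2r `|e|) (lt_le_trans rx)//.
  rewrite -[in leLHS](addrK (t *: e) x) (le_trans (ler_normB _ _))// lerD2l normrZ.
  by rewrite ler_piMl// ler_norml; lra.
- by move=> t x _; exact: is_derive_line.
- move=> t x _; apply: (@continuous_comp _ _ _ (fun z : R * V => z.2 + z.1 *: e)).
    apply: cvgD; first exact: cvg_snd.
    by apply: cvgZr_tmp; exact: cvg_fst.
  exact: cpF.
- by rewrite in_itv/=; lra.
rewrite -[LHS](@eq_vint (fun x => partial j F (x + 0 *: e))); last first.
  by move=> x; rewrite scale0r addr0.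
rewrite -(@derive_val _ _ _ _ _ _ _ D).
rewrite (_ : (fun s => _) = cst (vint F)); first by rewrite derive_cst.
by apply/funext => s; apply: vint_shift; exact: vintegrable_compact sF.
Qed.

End vint_theory.

(** * Integration by parts *)

Section calculus.
Context {R : realType} {d : nat}.
Local Notation V := 'rV[R]_d.
Implicit Types (f g h : V -> R) (r : R) (w : V -> V) (j : 'I_d).

Lemma C1_continuous g : C1 g -> continuous g.
Proof. by move=> [dg _] x; exact: differentiable_continuous. Qed.

Lemma C1_derivable g x v : C1 g -> derivable g x v.
Proof. by move=> [dg _]; exact: diff_derivable. Qed.

Lemma continuousMf f g : continuous f -> continuous g ->
  continuous (fun x => f x * g x).
Proof. by move=> cf cg x; exact: (cvgM (cf x) (cg x)). Qed.

Lemma continuousDf f g : continuous f -> continuous g ->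
  continuous (fun x => f x + g x).
Proof. by move=> cf cg x; exact: (cvgD (cf x) (cg x)). Qed.

Lemma continuousNf f : continuous f -> continuous (fun x => - f x).
Proof. by move=> cf x; exact: (cvgN (cf x)). Qed.

Lemma continuousXf f n : continuous f -> continuous (fun x => f x ^+ n).
Proof.
move=> cf; elim: n => [|n IH].
  by under eq_fun do rewrite expr0; exact: cst_continuous.
by under eq_fun do rewrite exprS; exact: continuousMf.
Qed.

Lemma continuous_sumf (I : Type) (s : seq I) (f : I -> V -> R) :
  (forall i, continuous (f i)) -> continuous (fun x => \sum_(i <- s) f i x).
Proof.
move=> cf; elim: s => [|i s IH].
  by under eq_fun do rewrite big_nil; exact: cst_continuous.
by under eq_fun do rewrite big_cons; exact: continuousDf.
Qed.

Lemma partialM j f g : (forall x, differentiable f x) -> (forall x, differentiable g x) ->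
  partial j (fun x => f x * g x) = (fun x => partial j f x * g x + f x * partial j g x).
Proof.
move=> df dg; apply/funext => x; rewrite /partial.
rewrite (@deriveM _ _ f g)/=; [|exact: diff_derivable..].
by rewrite addrC [g x *: _]mulrC.
Qed.

Lemma partialD j f g : (forall x, differentiable f x) -> (forall x, differentiable g x) ->
  partial j (fun x => f x + g x) = (fun x => partial j f x + partial j g x).
Proof.
by move=> df dg; apply/funext => x; rewrite /partial deriveD//; exact: diff_derivable.
Qed.

Lemma partialN j f : (forall x, differentiable f x) ->
  partial j (fun x => - f x) = (fun x => - partial j f x).
Proof.
by move=> df; apply/funext => x; rewrite /partial deriveN//; exact: diff_derivable.
Qed.

Lemma C1M f g : C1 f -> C1 g -> C1 (fun x => f x * g x).
Proof.
move=> cf cg; have [df pf] := cf; have [dg pg] := cg; split.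
  by move=> x; exact: (differentiableM (df x) (dg x)).
move=> j; rewrite partialM//.
by apply: continuousDf; apply: continuousMf => //; exact: C1_continuous.
Qed.

Lemma C1D f g : C1 f -> C1 g -> C1 (fun x => f x + g x).
Proof.
move=> cf cg; have [df pf] := cf; have [dg pg] := cg; split.
  by move=> x; exact: (differentiableD (df x) (dg x)).
by move=> j; rewrite partialD//; exact: continuousDf.
Qed.

Lemma C1N f : C1 f -> C1 (fun x => - f x).
Proof.
move=> cf; have [df pf] := cf; split.
  by move=> x; exact: (differentiableN (df x)).
by move=> j; rewrite partialN//; exact: continuousNf.
Qed.

Lemma C1B f g : C1 f -> C1 g -> C1 (fun x => f x - g x).
Proof. by move=> cf cg; apply: C1D => //; exact: C1N. Qed.

Lemma partialB j f g : (forall x, differentiable f x) -> (forall x, differentiable g x) ->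
  partial j (fun x => f x - g x) = (fun x => partial j f x - partial j g x).
Proof.
move=> df dg; rewrite partialD//; last by move=> x; exact: (differentiableN (dg x)).
by rewrite partialN.
Qed.

Lemma partial_vanishes r j g : vanishes_outside r g -> vanishes_outside r (partial j g).
Proof.
move=> sg x rx; rewrite /partial; transitivity ('D_(delta_mx 0 j) (cst 0 : V -> R) x); last first.
  by rewrite derive_cst.
apply: near_eq_derive.
have : \forall y \near x, r < `|y|.
  exact: (cvgr_gt `|x| (@norm_continuous _ _ x) _ rx).
by apply: filterS => y ry; rewrite sg.
Qed.

Lemma vanishesMl r f g : vanishes_outside r f -> vanishes_outside r (fun x => f x * g x).
Proof. by move=> sf x rx; rewrite sf// mul0r. Qed.

Lemma vanishesMr r f g : vanishes_outside r g -> vanishes_outside r (fun x => f x * g x).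
Proof. by move=> sf x rx; rewrite sf// mulr0. Qed.

Lemma vanishes_sum r (I : finType) (f : I -> V -> R) :
  (forall i, vanishes_outside r (f i)) -> vanishes_outside r (fun x => \sum_i f i x).
Proof. by move=> sf x rx; rewrite big1// => i _; exact: sf. Qed.

Lemma vint_by_parts r j f g : C1 f -> C1 g -> vanishes_outside r f ->
  vint (fun x => f x * partial j g x) = - vint (fun x => partial j f x * g x).
Proof.
move=> cf cg sf; have [df pf] := cf; have [dg pg] := cg.
have cfg := C1M cf cg.
have dfg x : derivable (fun x => f x * g x) x (delta_mx 0 j) by apply: C1_derivable.
have := vint_partial (C1_continuous cfg) (vanishesMl g sf) dfg (cfg.2 j).
rewrite partialM// vintD.
- by move/eqP; rewrite addr_eq0 => /eqP ->; rewrite opprK.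
- apply: (@vintegrable_compact _ _ r); last exact/vanishesMl/partial_vanishes.
  by apply: continuousMf => //; exact: C1_continuous.
- apply: (@vintegrable_compact _ _ r); last exact/vanishesMl.
  by apply: continuousMf => //; exact: C1_continuous.
Qed.

(** Integration by parts against each [f * w_j] leaves a term [f * divergence w], which vanishes. *)
Lemma vint_transport r f g w : C1 f -> C1 g -> vanishes_outside r f ->
  (forall j, C1 (component w j)) -> (forall x, divergence w x = 0) ->
  vint (fun x => f x * \sum_j w x 0 j * partial j g x) =
  - vint (fun x => (\sum_j w x 0 j * partial j f x) * g x).
Proof.
move=> cf cg sf cw divw; have [df pf] := cf; have [dg pg] := cg.
have cfw j : C1 (fun x => f x * w x 0 j) by apply: C1M => //; exact: (cw j).
have cwj j : continuous (fun x => w x 0 j) := C1_continuous (cw j).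
transitivity (vint (fun x => \sum_j (f x * w x 0 j) * partial j g x)).
  by apply: eq_vint => x; rewrite mulr_sumr; under eq_bigr do rewrite mulrA.
rewrite vint_sum; last first.
  move=> j; apply: (@vintegrable_compact _ _ r); last by do 2 apply: vanishesMl.
  by apply: continuousMf => //; apply: C1_continuous.
under eq_bigr => j _ do rewrite (vint_by_parts _ (cfw j) cg (vanishesMl _ sf)).
rewrite sumrN -vint_sum; last first.
  move=> j; apply: (@vintegrable_compact _ _ r).
    by apply: continuousMf; [exact: (cfw j).2|exact: C1_continuous].
  by apply/vanishesMl/partial_vanishes/vanishesMl.
congr (- _); apply: eq_vint => x; rewrite -mulr_suml; congr (_ * _).
under eq_bigr => j _ do rewrite (partialM j df (cw j).1) [X in X + _]mulrC.
by rewrite big_split/= -mulr_sumr -/(divergence w x) divw mulr0 addr0.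
Qed.

End calculus.

(** * The cutoff functions *)

Section cutoff.
Context {R : realType}.

(** Unlike the positive part, its square is C^1 across 0; [bump] is its composition with a quadratic
    polynomial. *)
Definition possq (y : R) : R := Num.max 0 y ^+ 2.

Lemma is_derive_possq (y : R) : is_derive y 1 possq (2 * Num.max 0 y).
Proof.
have [y0|y0|<-] := ltgtP 0 y.
- have H : is_derive y 1 (fun z : R => z ^+ 2) (2 * y).
    apply: (is_derive_eq (is_deriveM (is_derive_id y 1) (is_derive_id y 1))).
    by rewrite [_ *: _]mulr1 mulr_natl.
  apply: near_eq_is_derive H => //; near=> z.
  by rewrite /possq max_r// ltW//; near: z; exact: lt_nbhsr.
- rewrite mulr0; have H : is_derive y 1 (cst 0 : R -> R) 0 by exact: is_derive_cst.
  apply: near_eq_is_derive H => //; near=> z.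
  by rewrite /possq max_l ?expr0n// ltW//; near: z; exact: lt_nbhsl.
- rewrite mulr0.
  (* At 0 the difference quotient is at most [|h|]. *)
  have H : h^-1 *: (possq (h *: (1 : R) + 0) - possq 0) @[h --> (0 : R)^'] --> (0 : R).
    apply/cvgr0Pnorm_lt => e e0; near=> h.
    have h0 : h != 0 by near: h; exact: nbhs_dnbhs_neq.
    rewrite addr0 [h *: _]mulr1 /possq maxxx expr0n subr0.
    rewrite (@le_lt_trans _ _ `|h|)//; last by near: h; exact: dnbhs0_lt.
    rewrite normrM normfV ler_pdivrMl ?normr_gt0// normrX -expr2 lerXn2r ?nnegrE//.
    by rewrite ger0_norm ?le_max ?lexx// ge_max normr_ge0 ler_norm.
  by apply: DeriveDef; [apply/cvg_ex; exists 0; exact: H|exact/cvg_lim].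
Unshelve. all: by end_near. Qed.

Context {d : nat}.
Local Notation V := 'rV[R]_d.

Implicit Types (r : R) (x : V).

(** The squared Euclidean norm, smooth where the sup norm is not. *)
Definition sqn (x : V) : R := \sum_i x 0 i ^+ 2.

Definition bump_root (r : R) (x : V) : R := Num.max 0 (1 - sqn x / r ^+ 2).

Definition bump (r : R) (x : V) : R := bump_root r x ^+ 2.

Lemma sqn_ge0 x : 0 <= sqn x.
Proof. by apply: sumr_ge0 => i _; exact: sqr_ge0. Qed.

Lemma differentiable_sqn x : differentiable sqn x.
Proof.
rewrite (_ : sqn = \sum_(i < d) (fun x : V => x 0 i ^+ 2)); last first.
  by apply/funext => y; rewrite fct_sumE.
apply: differentiable_sum => i.
by apply: (@differentiableM _ _ (fun x : V => x 0 i) (fun x : V => x 0 i));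
  exact: differentiable_coord.
Qed.

Lemma partial_coord (i j : 'I_d) (x : V) :
  partial j (fun x : V => x 0 i) x = (i == j)%:R.
Proof.
apply/cvg_lim => //; apply: cvg_near_cst.
near=> h; have h0 : h != 0 by near: h; exact: nbhs_dnbhs_neq.
by rewrite /shift/= !mxE addrK eqxx/= [_ *: _]mulrA mulVf// mul1r.
Unshelve. all: by end_near. Qed.

Lemma partial_sqn j x : partial j sqn x = 2 * x 0 j.
Proof.
rewrite (_ : sqn = \sum_(i < d) (fun x : V => x 0 i ^+ 2)); last first.
  by apply/funext => y; rewrite fct_sumE.
have dc i y : differentiable (fun x : V => x 0 i) y by exact: differentiable_coord.
rewrite /partial derive_sum; last first.
  by move=> i; apply: diff_derivable; exact: (differentiableM (dc i x) (dc i x)).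
rewrite (bigD1 j)//= big1 ?addr0 => [|i ij].
  rewrite -/(partial j (fun x : V => x 0 j * x 0 j) x) partialM//.
  by rewrite partial_coord eqxx mul1r mulr1 mulr_natl.
rewrite -/(partial j (fun x : V => x 0 i * x 0 i) x) partialM//.
by rewrite partial_coord (negPf ij) mul0r mulr0 addr0.
Qed.

Lemma continuous_coordf (i : 'I_d) : continuous (fun x : V => x 0 i).
Proof. by move=> x; exact: coord_continuous. Qed.

Lemma continuous_max0 : continuous (fun y : R => Num.max 0 y).
Proof.
move=> y; apply: (@continuous_max _ _ (cst 0 : R -> R) id).
  exact: cst_continuous.
exact: cvg_id.
Qed.

Lemma continuous_bump_root r : continuous (bump_root r).
Proof.
move=> x; apply: (@continuous_comp _ _ _ (fun x => 1 - sqn x / r ^+ 2)); last first.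
  exact: continuous_max0.
have : differentiable (fun x => 1 - sqn x / r ^+ 2) x.
  by apply: differentiableB => //; apply: differentiableM => //; exact: differentiable_sqn.
exact: differentiable_continuous.
Qed.

Lemma diff_bump r x : differentiable (bump r) x /\
  forall j, partial j (bump r) x = - (4 * bump_root r x * x 0 j / r ^+ 2).
Proof.
pose q (x : V) : R := 1 - r ^- 2 * sqn x.
have E : bump r = possq \o q.
  by apply/funext => y; rewrite /bump /bump_root /possq /q/= mulrC.
have dq : differentiable q x.
  apply: differentiableB => //.
  by apply: (@differentiableZ _ _ _ sqn (r ^- 2)); exact: differentiable_sqn.
have [Dp1 Dp2] := is_derive_possq (q x).
have dp : differentiable possq (q x) by apply/derivable1_diffP.
rewrite E; split=> [|j]; first exact: differentiable_comp.
rewrite /partial deriveE; last exact: differentiable_comp.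
rewrite diff_comp//= deriv1E// -deriveE// derive1E Dp2.
have -> : 'D_(delta_mx 0 j) q x = - (r ^- 2 * (2 * x 0 j)).
  rewrite -/(partial j q x) /q partialB//; last first.
    by move=> y; apply: (@differentiableZ _ _ _ sqn (r ^- 2)); exact: differentiable_sqn.
  rewrite {1}/partial derive_cst sub0r; congr (- _).
  rewrite /partial (@deriveZ _ _ _ sqn); last by apply: diff_derivable; exact: differentiable_sqn.
  by rewrite -/(partial j sqn x) partial_sqn.
have -> : bump_root r x = Num.max 0 (q x) by rewrite /bump_root /q mulrC.
by rewrite /GRing.scale/=; move: (Num.max 0 (q x)) (r ^+ 2)^-1 => m s; ring.
Qed.

Lemma C1_bump r : C1 (bump r).
Proof.
split=> [x|j]; first exact: (diff_bump r x).1.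
rewrite (_ : partial j (bump r) = fun x => bump_root r x * x 0 j * (- (4 / r ^+ 2))).
  apply: continuousMf; last exact: cst_continuous.
  by apply: continuousMf; [exact: continuous_bump_root|exact: continuous_coordf].
by apply/funext => x; rewrite ((diff_bump r x).2 j); ring.
Qed.

Lemma bump_root_ge0 r x : 0 <= bump_root r x.
Proof. by rewrite le_max lexx. Qed.

Lemma bump_root_le1 r x : bump_root r x <= 1.
Proof.
rewrite ge_max ler01/= lerBlDl lerDr divr_ge0 ?sqn_ge0//.
exact: sqr_ge0.
Qed.

Lemma bump_ge0 r x : 0 <= bump r x.
Proof. exact: sqr_ge0. Qed.

Lemma bump_le1 r x : bump r x <= 1.
Proof. by rewrite expr_le1// ?bump_root_ge0 ?bump_root_le1. Qed.

Lemma bump_root_vanishes r : 0 < r -> vanishes_outside r (bump_root r).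
Proof.
move=> r0 x rx; rewrite /bump_root max_l// subr_le0 ler_pdivlMr ?exprn_gt0// mul1r.
have : exists i, r < `|x 0 i|.
  apply: contrapT => /forallNP h; move: rx; rewrite ltNge => /negP; apply.
  by apply/(normr_row_le _ (ltW r0)) => i; rewrite leNgt; apply/negP.
move=> [i ri]; rewrite /sqn (bigD1 i)//= -[x 0 i ^+ 2]real_normK ?num_real//.
apply: (@le_trans _ _ (`|x 0 i| ^+ 2)).
  by rewrite lerXn2r ?nnegrE// ltW.
by rewrite lerDl; apply: sumr_ge0 => k _; exact: sqr_ge0.
Qed.

Lemma bump_vanishes r : 0 < r -> vanishes_outside r (bump r).
Proof. by move=> r0 x rx; rewrite /bump bump_root_vanishes// expr0n. Qed.

(* The reason for squaring in [bump]: commutators with the cutoff are controlled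
   by the local energy. *)
Lemma sum_sqr_partial_bump r x : 0 < r ->
  \sum_j partial j (bump r) x ^+ 2 <= 16 / r ^+ 2 * bump r x.
Proof.
move=> r0.
have -> : \sum_j partial j (bump r) x ^+ 2 = 16 / r ^+ 2 * (bump r x * (sqn x / r ^+ 2)).
  rewrite /sqn mulr_suml !mulr_sumr; apply: eq_bigr => j _.
  rewrite ((diff_bump r x).2 j) /bump; field; exact: lt0r_neq0.
have r2 : 0 < r ^+ 2 by rewrite exprn_gt0.
apply: ler_wpM2l; first by rewrite divr_ge0// ltW.
have [xr|xr] := leP (sqn x / r ^+ 2) 1; first by rewrite ler_piMr// bump_ge0.
rewrite /bump /bump_root max_l ?expr0n ?mul0r//.
by rewrite subr_le0 ltW.
Qed.

Lemma bump_cvg x : bump n.+1%:R x @[n --> \oo] --> (1 : R).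
Proof.
have H : n.+1%:R^-1 @[n --> \oo] --> (0 : R) by exact: cvg_harmonic.
have cq : 1 - sqn x / n.+1%:R ^+ 2 @[n --> \oo] --> (1 : R).
  rewrite (_ : nbhs (1 : R) = nbhs (1 - sqn x * (0 * 0))); last by rewrite !mulr0 subr0.
  apply: cvgB; first exact: cvg_cst.
  under eq_fun do rewrite -exprVn.
  by apply: cvgM; [exact: cvg_cst|exact: (cvgM H H)].
have cm : bump_root n.+1%:R x @[n --> \oo] --> Num.max 0 (1 : R).
  apply: (@cvg_comp _ _ _ _ (fun y : R => Num.max 0 y) _ _ _ cq).
  exact: continuous_max0.
rewrite max_r ?ler01// in cm.
rewrite [X in X @ _ --> _](_ : _ = fun n : nat => bump_root n.+1%:R x * bump_root n.+1%:R x)//.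
have -> : nbhs (1 : R) = nbhs ((1 : R) * 1) by rewrite mulr1.
exact: (cvgM cm cm).
Qed.

End cutoff.

(** * Orthogonality of divergence-free fields and gradients *)

Section orthogonality.
Context {R : realType} {d : nat}.
Local Notation V := 'rV[R]_d.
Local Notation RT := (measurableTypeR R).
Implicit Types (f g h p : V -> R) (r : R) (w : V -> V) (j : 'I_d).

Lemma partial_shift j g (v x : V) :
  partial j (fun y => g (y + v)) x = partial j g (x + v).
Proof.
apply: (f_equal (fun F : R -> R => lim (F @ 0^'))).
by apply/funext => h /=; rewrite addrA.
Qed.

Lemma differentiable_shift g (v x : V) : differentiable g (x + v) ->
  differentiable (fun y => g (y + v)) x.
Proof.
move=> dg; apply: (@differentiable_comp _ _ _ _ (fun y : V => y + v) g) => //.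
Qed.

Lemma continuous_shiftf g (v : V) : continuous g -> continuous (fun x : V => g (x + v)).
Proof.
move=> cg x; apply: (@continuous_comp _ _ _ (fun y : V => y + v) g).
  exact: (cvgD cvg_id (cvg_cst v)).
exact: cg.
Qed.

Lemma C1_shift g (v : V) : C1 g -> C1 (fun x => g (x + v)).
Proof.
move=> [dg pg]; split=> [x|j]; first exact: differentiable_shift.
have -> : partial j (fun x => g (x + v)) = fun x => partial j g (x + v).
  by apply/funext => x; rewrite partial_shift.
exact: continuous_shiftf.
Qed.

Lemma sum_Cauchy_Schwarz (I : finType) (a b : I -> R) :
  (\sum_i a i * b i) ^+ 2 <= (\sum_i a i ^+ 2) * (\sum_i b i ^+ 2).
Proof.
apply: quadratic_ge0; last by apply: sumr_ge0 => i _; exact: sqr_ge0.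
move=> l; rewrite !mulr_sumr -sumrB -big_split/=; apply: sumr_ge0 => i _.
by rewrite (_ : _ + _ = (l * a i - b i) ^+ 2) ?sqr_ge0//; ring.
Qed.

Lemma vmeasurable_le_coord (i : 'I_d) (c : R) :
  vmeasurable (fun x : V => (x 0 i <= c)%R%:R).
Proof.
rewrite /vmeasurable (_ : _ \o _ = \1_[set t : d.-tuple RT | (tnth t i <= c)%R]).
  apply: measurable_indic.
  rewrite (_ : [set _ | _] = (fun t : d.-tuple RT => tnth t i) @^-1` `]-oo, c]).
    by rewrite -[X in measurable X]setTI; exact: measurable_tnth.
  by apply/seteqP; split=> t /=; rewrite in_itv.
by apply/funext => t /=; rewrite indicE mxE; case: leP => h;
  [rewrite mem_set|rewrite memNset//=; apply/negP; rewrite -ltNge].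
Qed.

Lemma vmeasurableM f g : vmeasurable f -> vmeasurable g -> vmeasurable (fun x => f x * g x).
Proof. by move=> mf mg; exact: measurable_funM mf mg. Qed.

Lemma vmeasurableB f g : vmeasurable f -> vmeasurable g -> vmeasurable (fun x => f x - g x).
Proof. by move=> mf mg; exact: measurable_funB mf mg. Qed.

Lemma vmeasurable_cst (c : R) : vmeasurable (fun _ : V => c).
Proof. exact: measurable_cst. Qed.

Lemma norm_le_sqrt (a b : R) : a ^+ 2 <= b -> `|a| <= Num.sqrt b.
Proof. by move=> ab; rewrite -sqrtr_sqr; apply: ler_wsqrtr. Qed.

Lemma le1_sqr (b : R) : 0 <= b -> b <= 1 -> b ^+ 2 <= b.
Proof. by move=> b0 b1; rewrite expr2 ler_piMl. Qed.

(** * The pairing of a divergence-free field with a translated gradient *)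

Section fixed_fields.
Variables (w : V -> V) (p : V -> R) (i0 : 'I_d).
Hypothesis cw : forall j, C1 (component w j).
Hypothesis divw : forall x, divergence w x = 0.
Hypothesis cp : C2 p.
Let w2 x := \sum_j w x 0 j ^+ 2.
Let q2 x := \sum_j partial j p x ^+ 2.
Hypothesis iw : vintegrable w2.
Hypothesis iq : vintegrable q2.

Let e : V := delta_mx 0 i0.
Let dot (s : R) x := \sum_j w x 0 j * partial j p (x + s *: e).
Let J r s := vint (fun x => bump r x * dot s x).
Let m r x := \sum_j w x 0 j * partial j (bump r) x.
(** The pairing after integration by parts: the gradient has moved to the cutoff, so [p] enters only
    through its values over a bounded set, and the integral makes sense whatever the growth of
    [p]. *)
Let K r s := vint (fun x => m r x * p (x + s *: e)).

Let cwj j : continuous (fun x => w x 0 j).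
Proof. exact: (C1_continuous (cw j)). Qed.

Let w2_ge0 x : 0 <= w2 x.
Proof. by apply: sumr_ge0 => j _; exact: sqr_ge0. Qed.

Let q2_ge0 x : 0 <= q2 x.
Proof. by apply: sumr_ge0 => j _; exact: sqr_ge0. Qed.

Let cdot s : continuous (dot s).
Proof.
apply: continuous_sumf => j; apply: continuousMf => //.
by apply: continuous_shiftf; exact: cp.1.2.
Qed.

Let cm r : continuous (m r).
Proof.
by apply: continuous_sumf => j; apply: continuousMf => //; exact: (C1_bump r).2.
Qed.

Let m_vanishes r : 0 < r -> vanishes_outside r (m r).
Proof.
by move=> r0; apply: vanishes_sum => j; apply/vanishesMr/partial_vanishes/bump_vanishes.
Qed.

Let JK r s : 0 < r -> J r s = - K r s.
Proof.
move=> r0; rewrite /J /K -(vint_transport (C1_bump r) _ (bump_vanishes r0) cw divw); last first.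
  exact: (C1_shift _ cp.1).
by apply: eq_vint => x; congr (_ * _); apply: eq_bigr => j _; rewrite partial_shift.
Qed.

Let dK (r s : R) : 0 < r -> is_derive s 1 (K r)
  (vint (fun x => m r x * partial i0 p (x + s *: e))).
Proof.
move=> r0.
have cshift x : continuous (fun z : R * V => z.2 + z.1 *: e).
  move=> z; apply: cvgD; first exact: cvg_snd.
  by apply: cvgZr_tmp; exact: cvg_fst.
have [|||||//] := @vint_derive R d (s - 1) (s + 1) r
  (fun s x => m r x * p (x + s *: e)) (fun s x => m r x * partial i0 p (x + s *: e)) _ _ _ _ s.
- move=> t _; apply: continuousMf => //; apply: continuous_shiftf.
  exact: C1_continuous cp.1.
- by move=> t _; apply: vanishesMl; exact: m_vanishes.
- move=> t x _; have H : is_derive t 1 (fun s => p (x + s *: e)) (partial i0 p (x + t *: e)).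
    by apply: is_derive_line; apply: C1_derivable; exact: cp.1.
  apply: (is_derive_eq (@is_deriveM _ _ (cst (m r x)) _ t 1 0 _ (is_derive_cst _ _ _) H)).
  by rewrite scaler0 addr0.
- move=> t x _; apply: (@cvgM _ _ _ _ (fun z : R * V => m r z.2)).
    by apply: (@continuous_comp _ _ _ (snd : R * V -> V)); [exact: cvg_snd|exact: cm].
  apply: (@continuous_comp _ _ _ (fun z : R * V => z.2 + z.1 *: e)); first exact: cshift.
  exact: cp.1.2.
- by rewrite in_itv/=; apply/andP; split; lra.
Qed.

(* In the derivative of [K r] the translated [p] occurs only through its
   gradient, and [|grad (bump r)| <= 4 / r]. *)
Let K_lipschitz (r s : R) : 0 < r -> 0 < s ->
  `|K r s - K r 0| <= s * (4 / r * Num.sqrt (vint w2 * vint q2)).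
Proof.
move=> r0 s0.
have [||c _ ->] := @MVT R (K r) (fun s => vint (fun x => m r x * partial i0 p (x + s *: e))) 0 s s0.
- by move=> t _; exact: dK.
- apply: derivable_within_continuous => t _.
  by have [] := dK t r0.
rewrite subr0 normrM mulrC (gtr0_norm s0) ler_pM2l//.
have -> : 4 / r * Num.sqrt (vint w2 * vint q2) =
    Num.sqrt (16 / r ^+ 2 * vint w2 * vint q2).
  rewrite -[in RHS]mulrA [in RHS]sqrtrM; last first.
    by apply: divr_ge0 => //; apply: ltW; rewrite exprn_gt0.
  congr (_ * _); rewrite (_ : 16 / _ = (4 / r) ^+ 2) ?sqrtr_sqr ?gtr0_norm ?divr_gt0//.
  by field; exact: lt0r_neq0.
apply: norm_le_sqrt.
have [||||||_] := @vint_Cauchy_Schwarz R d (fun x => m r x * partial i0 p (x + c *: e))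
  (fun x => 16 / r ^+ 2 * w2 x) (fun x => q2 (x + c *: e)).
- apply: continuous_vmeasurable; apply: continuousMf => //.
  by apply: continuous_shiftf; exact: cp.1.2.
- exact: vintegrableZ.
- exact: vintegrable_shift.
- by move=> x; rewrite mulr_ge0// divr_ge0// ltW// exprn_gt0.
- by move=> x; exact: q2_ge0.
- move=> x; rewrite exprMn ler_pM ?sqr_ge0//.
    apply: (le_trans (sum_Cauchy_Schwarz _ _)).
    rewrite mulrC; apply: ler_wpM2r; first exact: w2_ge0.
    apply: (le_trans (sum_sqr_partial_bump _ r0)).
    by rewrite ler_piMr ?bump_le1// divr_ge0// ltW// exprn_gt0.
  by rewrite /q2 (bigD1 i0)//= lerDl; apply: sumr_ge0 => j _; exact: sqr_ge0.
- by rewrite vint_shift// vintZ.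
Qed.

(** The mass of [w] where [x_i0 <= - n] and that of the gradient of [p] where [x_i0 > n]. Both tend
    to 0 by dominated convergence. *)
Let tail n := vint (fun x => (x 0 i0 <= - n%:R)%R%:R * w2 x).
Let tail' n := vint (fun x => (1 - (x 0 i0 <= n%:R)%R%:R) * q2 x).

Let tail_cvg0 : tail n @[n --> \oo] --> (0 : R).
Proof.
rewrite -(@vint0 R d).
have [||||//] := @vint_dominated R d (fun n x => (x 0 i0 <= - n%:R)%R%:R * w2 x) (fun=> 0) w2.
- move=> n; apply: vmeasurableM; first exact: vmeasurable_le_coord.
  exact: (vintegrable_measurable iw).
- exact: iw.
- by move=> n x; case: (x 0 i0 <= - n%:R); rewrite ?mul1r ?mul0r ?normr0 ?ger0_norm ?w2_ge0//.
- move=> x; apply: cvg_near_cst; near=> n.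
  rewrite leNgt (_ : _ < _ = true) ?mul0r//.
  rewrite ltrNl (le_lt_trans (ler_norm _))// normrN.
  near: n; exact: nbhs_infty_gtr.
Unshelve. all: by end_near. Qed.

Let tail'_cvg0 : tail' n @[n --> \oo] --> (0 : R).
Proof.
rewrite -(@vint0 R d).
have [||||//] := @vint_dominated R d (fun n x => (1 - (x 0 i0 <= n%:R)%R%:R) * q2 x) (fun=> 0) q2.
- move=> n; apply: vmeasurableM; last exact: (vintegrable_measurable iq).
  by apply: vmeasurableB; [exact: vmeasurable_cst|exact: vmeasurable_le_coord].
- exact: iq.
- move=> n x; case: (x 0 i0 <= n%:R); rewrite ?subrr ?subr0 ?mul1r ?mul0r ?normr0 ?ger0_norm ?q2_ge0//.
- move=> x; apply: cvg_near_cst; near=> n.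
  rewrite (_ : _ <= _ = true) ?subrr ?mul0r//.
  rewrite (le_trans (ler_norm _))// ltW//.
  near: n; exact: nbhs_infty_gtr.
Unshelve. all: by end_near. Qed.

(* Shifting by [2 n] moves the half space [x_i0 <= n] to [x_i0 <= - n]. *)
Let J_decay r n : 0 < r -> `|J r (n%:R + n%:R)| <=
  Num.sqrt (tail n * vint q2) + Num.sqrt (vint w2 * tail' n).
Proof.
move=> r0; set s := n%:R + n%:R.
pose b (x : V) : R := (x 0 i0 <= - n%:R :> R)%R%:R.
have b01 x : b x = 0 \/ b x = 1 by rewrite /b; case: (x 0 i0 <= - n%:R); [right|left].
have mb : vmeasurable b by exact: vmeasurable_le_coord.
have mbd : vmeasurable (fun x => bump r x * dot s x).
  apply: continuous_vmeasurable; apply: continuousMf => //.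
  exact: C1_continuous (C1_bump r).
have bdot x : (bump r x * dot s x) ^+ 2 <= w2 x * q2 (x + s *: e).
  rewrite exprMn (le_trans _ (sum_Cauchy_Schwarz _ _))//.
  rewrite ler_piMl ?sqr_ge0// (le_trans (le1_sqr (bump_ge0 _ _) (bump_le1 _ _)))//.
  exact: bump_le1.
have tail'E : tail' n = vint (fun x => (1 - b x) * q2 (x + s *: e)).
  rewrite /tail' -(vint_shift (s *: e)).
    apply: eq_vint => x; congr ((1 - _%:R) * _).
    by rewrite !mxE !eqxx/= mulr1 /b /s -lerBrDr opprD addrA subrr sub0r.
  apply: (vintegrable_le _ iq).
    apply: vmeasurableM; last exact: (vintegrable_measurable iq).
    by apply: vmeasurableB; [exact: vmeasurable_cst|exact: vmeasurable_le_coord].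
  move=> x; case: (x 0 i0 <= n%:R); rewrite ?subrr ?subr0 ?mul1r ?mul0r ?normr0 ?ger0_norm ?q2_ge0//.
have iq' : vintegrable (fun x => q2 (x + s *: e)) by exact: vintegrable_shift.
(* The pairing is split along [x_i0 = - n]: on the lower side the factor [w] is small, on the upper
   side the translated gradient is. *)
have [||||||i1 H1] := @vint_Cauchy_Schwarz R d (fun x => b x * (bump r x * dot s x))
    (fun x => b x * w2 x) (fun x => q2 (x + s *: e)).
- exact: (vmeasurableM mb mbd).
- apply: (vintegrable_le _ iw); first by apply: vmeasurableM; [exact: mb|]; exact: (vintegrable_measurable iw).
  by move=> x; case: (b01 x) => ->; rewrite ?mul0r ?mul1r ?normr0 ?ger0_norm ?w2_ge0//.
- exact: iq'.
- by move=> x; case: (b01 x) => ->; rewrite ?mul0r ?mul1r ?w2_ge0.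
- by move=> x; exact: q2_ge0.
- move=> x; case: (b01 x) => ->; rewrite ?mul0r ?mul1r ?expr0n//; exact: bdot.
have [||||||i2 H2] := @vint_Cauchy_Schwarz R d (fun x => (1 - b x) * (bump r x * dot s x))
    w2 (fun x => (1 - b x) * q2 (x + s *: e)).
- exact: (vmeasurableM (vmeasurableB (vmeasurable_cst 1) mb) mbd).
- exact: iw.
- apply: (vintegrable_le (vmeasurableM (vmeasurableB (vmeasurable_cst 1) mb)
    (vintegrable_measurable iq')) iq').
  by move=> x; case: (b01 x) => ->; rewrite ?subrr ?subr0 ?mul0r ?mul1r ?normr0 ?ger0_norm ?q2_ge0//.
- by move=> x; exact: w2_ge0.
- by move=> x; case: (b01 x) => ->; rewrite ?subrr ?subr0 ?mul0r ?mul1r ?q2_ge0.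
- move=> x; case: (b01 x) => ->; rewrite ?subrr ?subr0 ?mul0r ?mul1r ?expr0n ?mulr0//; exact: bdot.
rewrite (vint_shift _ iq) in H1; rewrite -tail'E in H2.
have -> : J r s = vint (fun x => b x * (bump r x * dot s x)) +
    vint (fun x => (1 - b x) * (bump r x * dot s x)).
  by rewrite -(vintD i1 i2); apply: eq_vint => x; rewrite -mulrDl addrC subrK mul1r.
apply: (le_trans (ler_normD _ _)).
by apply: lerD; [exact: norm_le_sqrt H1|exact: norm_le_sqrt H2].
Qed.

Lemma vintegrable_dot : vintegrable (dot 0).
Proof.
apply: (vintegrable_le _ (vintegrableD iw iq)).
  exact: continuous_vmeasurable.
move=> x; rewrite (_ : dot 0 x = \sum_j w x 0 j * partial j p x); last first.
  by apply: eq_bigr => j _; rewrite scale0r addr0.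
rewrite /w2 /q2 -big_split/= (le_trans (ler_norm_sum _ _ _))//.
apply: ler_sum => j _; rewrite normrM.
have := sqr_ge0 (`|w x 0 j| - `|partial j p x|).
rewrite -[w x 0 j ^+ 2]real_normK ?num_real// -[partial j p x ^+ 2]real_normK ?num_real//.
rewrite sqrrB => H; have := normr_ge0 (w x 0 j); have := normr_ge0 (partial j p x); nra.
Qed.

(** The order of the limits matters. The cost of a translation by [2 n] is of order [n / k] for the
    radius [k + 1], so [k] goes to infinity with [n] fixed, and only then does [n]. *)
Lemma vint_dot_gradient0 : vint (dot 0) = 0.
Proof.
have J_cvg : J n.+1%:R 0 @[n --> \oo] --> vint (dot 0).
  have [||||//] := @vint_dominated R d (fun n x => bump n.+1%:R x * dot 0 x) (dot 0)
    (fun x => `|dot 0 x|).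
  - move=> n; apply: continuous_vmeasurable; apply: continuousMf => //.
    exact: C1_continuous (C1_bump _).
  - exact/vintegrable_norm/vintegrable_dot.
  - move=> n x; rewrite normrM ler_piMl// ger0_norm ?bump_ge0//.
    exact: bump_le1.
  - move=> x; rewrite -[X in _ --> X]mul1r; apply: cvgM; last exact: cvg_cst.
    exact: bump_cvg.
pose B := Num.sqrt (vint w2 * vint q2).
pose eps n := Num.sqrt (tail n * vint q2) + Num.sqrt (vint w2 * tail' n).
have H n k : `|J k.+1%:R 0| <= eps n + (n%:R + n%:R) * (4 * k.+1%:R^-1 * B).
  have k0 : 0 < k.+1%:R :> R by rewrite ltr0Sn.
  rewrite -[J _ 0](subrK (J k.+1%:R (n%:R + n%:R))) addrC.
  rewrite (le_trans (ler_normD _ _))// lerD//; first exact: J_decay.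
  (* [K_lipschitz] wants a positive translation; for [n = 0] there is none. *)
  case: n => [|n]; first by rewrite addr0 subrr normr0 mul0r.
  rewrite !JK// opprK addrC.
  by apply: K_lipschitz => //; rewrite addr_gt0// ltr0Sn.
have H2 n : `|vint (dot 0)| <= eps n.
  have C1 : `|J k.+1%:R 0| @[k --> \oo] --> `|vint (dot 0)| by exact: cvg_norm J_cvg.
  have C2 : eps n + (n%:R + n%:R) * (4 * k.+1%:R^-1 * B) @[k --> \oo] --> eps n.
    rewrite -[X in _ --> X]addr0 -[X in _ --> eps n + X](mulr0 (n%:R + n%:R)).
    rewrite -[X in _ --> eps n + _ * X](mul0r B) -[X in _ --> eps n + _ * (X * _)](mulr0 4).
    apply: cvgD; first exact: cvg_cst.
    apply: cvgM; first exact: cvg_cst.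
    apply: cvgM; last exact: cvg_cst.
    by apply: cvgM; [exact: cvg_cst|exact: cvg_harmonic].
  apply: (ler_cvg_to C1 C2); apply: nearW => k; exact: H.
have eps0 : eps n @[n --> \oo] --> (0 : R).
  rewrite -[X in _ --> X]addr0 -sqrtr0.
  apply: cvgD.
    rewrite -[X in _ --> Num.sqrt X](mul0r (vint q2)).
    apply: (@cvg_comp _ _ _ _ Num.sqrt); last exact: sqrt_continuous.
    by apply: cvgM; [exact: tail_cvg0|exact: cvg_cst].
  rewrite -[X in _ --> Num.sqrt X](mulr0 (vint w2)).
  apply: (@cvg_comp _ _ _ _ Num.sqrt); last exact: sqrt_continuous.
  by apply: cvgM; [exact: cvg_cst|exact: tail'_cvg0].
apply/eqP; rewrite -normr_le0.
by apply: (ler_cvg_to (cvg_cst _) eps0); apply: nearW => n; exact: H2.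
Qed.

End fixed_fields.

Lemma orthogonal_gradient w p :
  (forall j, C1 (component w j)) -> (forall x, divergence w x = 0) -> C2 p ->
  vintegrable (fun x => \sum_j w x 0 j ^+ 2) ->
  vintegrable (fun x => \sum_j partial j p x ^+ 2) ->
  vintegrable (fun x => \sum_j w x 0 j * partial j p x) /\
  vint (fun x => \sum_j w x 0 j * partial j p x) = 0.
Proof.
move=> cw divw cp iw iq.
(* In dimension 0 there is no direction of translation, but all sums are empty. *)
have [i0 _|noI] := pickP (predT : pred 'I_d); last first.
  have E (a : 'I_d -> R) : \sum_j a j = 0 by apply: big1 => i; have := noI i.
  under eq_fun do rewrite E.
  by split; [exact: vintegrable0|exact: vint0].
have E : (fun x => \sum_j w x 0 j * partial j p (x + 0 *: delta_mx 0 i0)) =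
    (fun x => \sum_j w x 0 j * partial j p x).
  by apply/funext => x; rewrite scale0r addr0.
split; first by rewrite -E; exact: vintegrable_dot.
by rewrite -E; exact: vint_dot_gradient0.
Qed.

End orthogonality.

(** * Local energy *)

Section energy.
Context {R : realType} {d : nat}.
Local Notation V := 'rV[R]_d.
Implicit Types (f g h p : V -> R) (r : R) (u v w : V -> V).

Lemma sqn_dot (x y : V) : (\sum_i x 0 i * y 0 i) ^+ 2 <= sqn x * sqn y.
Proof. exact: sum_Cauchy_Schwarz. Qed.

Lemma continuous_sqnf v : (forall i, continuous (component v i)) ->
  continuous (fun x => sqn (v x)).
Proof. by move=> cv; apply: continuous_sumf => i; apply: continuousXf; exact: cv. Qed.

Lemma vintegrable_dot2 v w : (forall i, continuous (component v i)) ->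
  (forall i, continuous (component w i)) ->
  vintegrable (fun x => sqn (v x)) -> vintegrable (fun x => sqn (w x)) ->
  vintegrable (fun x => \sum_i v x 0 i * w x 0 i) /\
  (vint (fun x => \sum_i v x 0 i * w x 0 i)) ^+ 2 <=
    vint (fun x => sqn (v x)) * vint (fun x => sqn (w x)).
Proof.
move=> cv cw iv iw; apply: vint_Cauchy_Schwarz.
- apply: continuous_vmeasurable; apply: continuous_sumf => i.
  by apply: continuousMf; [exact: cv|exact: cw].
- exact: iv.
- exact: iw.
- by move=> x; exact: sqn_ge0.
- by move=> x; exact: sqn_ge0.
- by move=> x; exact: sqn_dot.
Qed.

Lemma sqnB (x y : V) : sqn (x - y) = sqn x - 2 * (\sum_i x 0 i * y 0 i) + sqn y.
Proof.
rewrite /sqn mulr_sumr -sumrB -big_split/=; apply: eq_bigr => i _.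
by rewrite !mxE; ring.
Qed.

Lemma vintegrable_sqnB v w : (forall i, continuous (component v i)) ->
  (forall i, continuous (component w i)) ->
  vintegrable (fun x => sqn (v x)) -> vintegrable (fun x => sqn (w x)) ->
  vintegrable (fun x => sqn (v x - w x)) /\
  vint (fun x => sqn (v x - w x)) = vint (fun x => sqn (v x)) -
    2 * vint (fun x => \sum_i v x 0 i * w x 0 i) + vint (fun x => sqn (w x)).
Proof.
move=> cv cw iv iw; have [id _] := vintegrable_dot2 cv cw iv iw.
have E : (fun x => sqn (v x - w x)) =
    (fun x => (sqn (v x) - 2 * (\sum_i v x 0 i * w x 0 i)) + sqn (w x)).
  by apply/funext => x; rewrite sqnB.
have i2 := vintegrableZ 2 id.
rewrite E; split; first exact: (vintegrableD (vintegrableB iv i2) iw).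
by rewrite (vintD (vintegrableB iv i2) iw) (vintB iv i2) (vintZ _ id).
Qed.

Lemma vint_sqn_ge0 v : 0 <= vint (fun x => sqn (v x)).
Proof. by apply: vint_ge0 => x; exact: sqn_ge0. Qed.

Lemma sqrt_vint_sqnB v w : (forall i, continuous (component v i)) ->
  (forall i, continuous (component w i)) ->
  vintegrable (fun x => sqn (v x)) -> vintegrable (fun x => sqn (w x)) ->
  Num.sqrt (vint (fun x => sqn (v x - w x))) <=
  Num.sqrt (vint (fun x => sqn (v x))) + Num.sqrt (vint (fun x => sqn (w x))).
Proof.
move=> cv cw iv iw; have [_ H] := vintegrable_dot2 cv cw iv iw.
have [_ ->] := vintegrable_sqnB cv cw iv iw.
move: (vint_sqn_ge0 v) (vint_sqn_ge0 w) H.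
move: (vint _) (vint _) (vint _) => A B c A0 B0 /norm_le_sqrt; rewrite sqrtrM// => H.
rewrite -[leRHS]ger0_norm ?addr_ge0 ?sqrtr_ge0// -sqrtr_sqr; apply: ler_wsqrtr.
rewrite sqrrD !sqr_sqrtr// -addrA -[leRHS]addrA lerD2l lerD2r.
move: H; rewrite ler_norml => /andP[H _]; rewrite -mulr_natr; lra.
Qed.

Lemma C1_component_grad p i : C2 p -> C1 (component (grad p) i).
Proof.
move=> [_ /(_ i)]; rewrite (_ : component (grad p) i = partial i p)//.
by apply/funext => x; rewrite /component mxE.
Qed.

Lemma divergenceD v w x : (forall i, C1 (component v i)) -> (forall i, C1 (component w i)) ->
  divergence (fun x => v x + w x) x = divergence v x + divergence w x.
Proof.
move=> cv cw; rewrite /divergence -big_split/=; apply: eq_bigr => i _.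
rewrite (_ : component (fun x => v x + w x) i =
    fun x => component v i x + component w i x); last first.
  by apply/funext => y; rewrite /component mxE.
by rewrite (partialD _ (cv i).1 (cw i).1).
Qed.

Lemma divergence_grad p x : divergence (grad p) x = laplacian p x.
Proof.
apply: eq_bigr => i _; rewrite (_ : component (grad p) i = partial i p)//.
by apply/funext => y; rewrite /component mxE.
Qed.

(** With [w = v + grad p], the sign in [- laplacian p = divergence v] makes [w] divergence free.
    Since [w] is orthogonal to [grad p], Pythagoras for [v = w - grad p] gives the contraction.
    Orthogonality presupposes [w] square integrable, which therefore comes first. *)
Lemma Leray_projection v p : (forall i, C1 (component v i)) -> C2 p ->
  (forall x, - laplacian p x = divergence v x) ->
  vintegrable (fun x => sqn (v x)) -> vintegrable (fun x => sqn (grad p x)) ->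
  [/\ forall i, C1 (component (fun x => v x + grad p x) i),
      forall x, divergence (fun x => v x + grad p x) x = 0,
      vintegrable (fun x => sqn (v x + grad p x)) &
      vint (fun x => sqn (v x + grad p x)) <= vint (fun x => sqn (v x))].
Proof.
move=> cv cp dvp iv iq.
have cg i : C1 (component (grad p) i) by exact: C1_component_grad.
have cw i : C1 (component (fun x => v x + grad p x) i).
  rewrite (_ : component _ i = fun x => component v i x + component (grad p) i x).
    exact: C1D.
  by apply/funext => y; rewrite /component mxE.
have dw x : divergence (fun x => v x + grad p x) x = 0.
  by rewrite divergenceD// divergence_grad -dvp addNr.
have cNg i : continuous (component (fun x => - grad p x) i).
  rewrite (_ : component _ i = fun x => - component (grad p) i x).
    by apply: continuousNf; exact: C1_continuous.
  by apply/funext => y; rewrite /component mxE.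
have EN : (fun x => sqn (- grad p x)) = (fun x => sqn (grad p x)).
  by apply/funext => x; apply: eq_bigr => i _; rewrite mxE sqrrN.
have iw : vintegrable (fun x => sqn (v x + grad p x)).
  have [] := @vintegrable_sqnB v (fun x => - grad p x) (fun i => C1_continuous (cv i)) cNg iv.
    by rewrite EN.
  by rewrite (_ : (fun x => sqn (v x - - grad p x)) = (fun x => sqn (v x + grad p x)))//;
     apply/funext => x; rewrite opprK.
split=> //.
have iq' : vintegrable (fun x => \sum_j partial j p x ^+ 2).
  move: iq; rewrite (_ : (fun x => sqn (grad p x)) = (fun x => \sum_j partial j p x ^+ 2))//.
  by apply/funext => x; apply: eq_bigr => i _; rewrite mxE.
have [_ o] := orthogonal_gradient cw dw cp iw iq'.
have [_ H] := vintegrable_sqnB (fun i => C1_continuous (cw i)) (fun i => C1_continuous (cg i)) iw iq.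
have E : (fun x => sqn (v x + grad p x - grad p x)) = (fun x => sqn (v x)).
  by apply/funext => x; rewrite addrK.
rewrite E in H; rewrite H.
rewrite (_ : vint (fun x => \sum_i (v x + grad p x) 0 i * grad p x 0 i) = 0).
  by rewrite mulr0 subr0 lerDl vint_sqn_ge0.
by rewrite -[RHS]o; apply: eq_vint => x; apply: eq_bigr => i _; rewrite [grad p x 0 i]mxE.
Qed.

Definition grad_sqn u x := \sum_ij nabla u ij x ^+ 2.

Lemma grad_sqn_ge0 u x : 0 <= grad_sqn u x.
Proof. by apply: sumr_ge0 => i _; exact: sqr_ge0. Qed.

Lemma grad_sqnE u x : grad_sqn u x = \sum_i \sum_j partial j (component u i) x ^+ 2.
Proof. by rewrite pair_bigA. Qed.

Definition local_energy r u := vint (fun x => bump r x * sqn (u x)).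

Lemma vintegrable_local_energy r u : 0 < r -> (forall i, continuous (component u i)) ->
  vintegrable (fun x => bump r x * sqn (u x)).
Proof.
move=> r0 cu; apply: (@vintegrable_compact _ _ r); last exact/vanishesMl/bump_vanishes.
by apply: continuousMf; [exact: C1_continuous (C1_bump r)|exact: continuous_sqnf].
Qed.

Lemma local_energy_ge0 r u : 0 <= local_energy r u.
Proof. by apply: vint_ge0 => x; rewrite mulr_ge0 ?bump_ge0 ?sqn_ge0. Qed.

(** Integration by parts yields a dissipation of good sign and a commutator with the cutoff. In the
    latter [|grad (bump r)|^2 <= 16 / r^2 * bump r], so Cauchy-Schwarz leaves the local energy, and
    [u] need not be square integrable. *)
Lemma viscous_bound r u : 0 < r -> (forall i, C2 (component u i)) ->
  vintegrable (grad_sqn u) ->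
  vint (fun x => bump r x * \sum_i u x 0 i * laplacian (component u i) x) <=
  4 / r * (Num.sqrt (local_energy r u) * Num.sqrt (vint (grad_sqn u))).
Proof.
move=> r0 cu iG; pose phi : V -> R := bump r; have cphi : C1 phi := C1_bump r.
have sphi : vanishes_outside r phi := bump_vanishes r0.
have cu1 i : C1 (component u i) := (cu i).1.
have cu0 i : continuous (component u i) := C1_continuous (cu1 i).
have cphiu i : C1 (fun x => phi x * component u i x) := C1M cphi (cu1 i).
have dphiu i j x : partial j (fun x => phi x * component u i x) x =
    partial j phi x * component u i x + phi x * partial j (component u i) x.
  by rewrite (partialM _ cphi.1 (cu1 i).1).
have ico g : continuous g -> vanishes_outside r g -> vintegrable g.
  by move=> cg sg; exact: vintegrable_compact sg.
(* [c] is the commutator with the cutoff; [q] is the weighted dissipation, whose integral is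
   nonnegative and will be dropped. *)
pose c x := \sum_ij partial ij.2 phi x * component u ij.1 x * nabla u ij x.
pose q x := phi x * grad_sqn u x.
have cc : continuous c.
  apply: continuous_sumf => ij; apply: continuousMf; last exact: (cu1 ij.1).2.
  by apply: continuousMf; [exact: cphi.2|exact: cu0].
have sc : vanishes_outside r c.
  by apply: vanishes_sum => ij; do 2 apply: vanishesMl; exact: partial_vanishes.
have cq : continuous q.
  apply: continuousMf; first exact: C1_continuous.
  by apply: continuous_sumf => ij; apply: continuousXf; exact: (cu1 ij.1).2.
have sq : vanishes_outside r q by exact: vanishesMl.
have -> : vint (fun x => phi x * \sum_i u x 0 i * laplacian (component u i) x) =
    - (vint c + vint q).
  transitivity (vint (fun x => \sum_ij (phi x * component u ij.1 x) *
      partial ij.2 (partial ij.2 (component u ij.1)) x)).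
    apply: eq_vint => x; rewrite mulr_sumr -(pair_bigA _ (fun i j =>
      phi x * component u i x * partial j (partial j (component u i)) x))/=.
    by apply: eq_bigr => i _; rewrite mulrA mulr_sumr.
  rewrite vint_sum; last first.
    move=> ij; apply: ico; last by do 2 apply: vanishesMl.
    by apply: continuousMf; [exact: C1_continuous|exact: ((cu ij.1).2 ij.2).2].
  rewrite -(vintD (ico _ cc sc) (ico _ cq sq)).
  under eq_bigr => ij _ do rewrite (vint_by_parts _ (cphiu ij.1) ((cu ij.1).2 ij.2) (vanishesMl _ sphi)).
  rewrite sumrN -vint_sum; last first.
    move=> ij; apply: ico.
      by apply: continuousMf; [exact: (cphiu ij.1).2|exact: (cu1 ij.1).2].
    by apply/vanishesMl/partial_vanishes/vanishesMl.
  congr (- _); apply: eq_vint => x; rewrite /c /q /grad_sqn mulr_sumr -big_split/=.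
  by apply: eq_bigr => ij _; rewrite dphiu mulrDl expr2 mulrA.
have q0 : 0 <= vint q.
  by apply: vint_ge0 => x; rewrite mulr_ge0 ?bump_ge0 ?grad_sqn_ge0.
apply: (@le_trans _ _ `|vint c|).
  by have := ler_norm (- vint c); rewrite normrN; move: q0; move: (vint q) (vint c) => *; lra.
have r2 : 0 < r ^+ 2 by rewrite exprn_gt0.
have k0 : 0 <= 16 / r ^+ 2 by rewrite divr_ge0// ltW.
have iE := vintegrable_local_energy r0 cu0.
have [||||||_ H] := @vint_Cauchy_Schwarz R d c
  (fun x => 16 / r ^+ 2 * (phi x * sqn (u x))) (grad_sqn u).
- exact: continuous_vmeasurable.
- exact: (vintegrableZ _ iE).
- exact: iG.
- by move=> x; rewrite mulr_ge0// mulr_ge0 ?bump_ge0 ?sqn_ge0.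
- by move=> x; exact: grad_sqn_ge0.
- move=> x; apply: (le_trans (sum_Cauchy_Schwarz _ _)).
  apply: ler_wpM2r; first exact: grad_sqn_ge0.
  rewrite -(pair_bigA _ (fun i j => (partial j phi x * component u i x) ^+ 2))/=.
  rewrite (_ : \sum_i _ = (\sum_j partial j phi x ^+ 2) * sqn (u x)).
    rewrite mulrA; apply: ler_wpM2r; first exact: sqn_ge0.
    exact: sum_sqr_partial_bump.
  rewrite /sqn mulr_sumr; apply: eq_bigr => i _; rewrite mulr_suml.
  by apply: eq_bigr => j _; rewrite exprMn.
rewrite (vintZ _ iE) in H.
rewrite (le_trans (norm_le_sqrt H))// -[16 / _ * _ * _]mulrA (sqrtrM _ k0).
rewrite (sqrtrM (vint (grad_sqn u)) (local_energy_ge0 r u)).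
rewrite (_ : 16 / _ = (4 / r) ^+ 2); first by rewrite sqrtr_sqr gtr0_norm ?divr_gt0.
by field; exact: lt0r_neq0.
Qed.

Lemma advect_bound (M : R) u : 0 <= M -> (forall x, sqn (u x) <= M ^+ 2) ->
  (forall i, C1 (component (advect u) i)) -> vintegrable (grad_sqn u) ->
  vintegrable (fun x => sqn (advect u x)) /\
  Num.sqrt (vint (fun x => sqn (advect u x))) <= M * Num.sqrt (vint (grad_sqn u)).
Proof.
move=> M0 uM ca iG.
have pt x : sqn (advect u x) <= M ^+ 2 * grad_sqn u x.
  apply: (@le_trans _ _ (sqn (u x) * grad_sqn u x)); last first.
    by apply: ler_wpM2r; [exact: grad_sqn_ge0|exact: uM].
  rewrite /sqn grad_sqnE mulr_sumr; apply: ler_sum => i _.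
  by rewrite mxE; exact: sum_Cauchy_Schwarz.
have iM := vintegrableZ (M ^+ 2) iG.
have ia : vintegrable (fun x => sqn (advect u x)).
  apply: (vintegrable_le _ iM).
    apply: continuous_vmeasurable; apply: continuous_sqnf => i.
    exact: C1_continuous.
  by move=> x; rewrite ger0_norm ?sqn_ge0.
split=> //.
have -> : M * Num.sqrt (vint (grad_sqn u)) = Num.sqrt (M ^+ 2 * vint (grad_sqn u)).
  by rewrite sqrtrM ?sqr_ge0// sqrtr_sqr ger0_norm.
by apply: ler_wsqrtr; rewrite -(vintZ _ iG); exact: (le_vint ia iM).
Qed.

(** By [bump^2 <= bump] the whole weight can go to [u]: the right-hand side then contains the square
    root of the local energy, which a later division removes. *)
Lemma weighted_dot_bound r u w : 0 < r -> (forall i, continuous (component u i)) ->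
  (forall i, continuous (component w i)) -> vintegrable (fun x => sqn (w x)) ->
  `|vint (fun x => bump r x * \sum_i u x 0 i * w x 0 i)| <=
  Num.sqrt (local_energy r u) * Num.sqrt (vint (fun x => sqn (w x))).
Proof.
move=> r0 cu cw iw.
have [||||||_ H] := @vint_Cauchy_Schwarz R d
  (fun x => bump r x * \sum_i u x 0 i * w x 0 i)
  (fun x => bump r x * sqn (u x)) (fun x => sqn (w x)).
- apply: continuous_vmeasurable; apply: continuousMf.
    exact: C1_continuous (C1_bump r).
  by apply: continuous_sumf => i; apply: continuousMf; [exact: cu|exact: cw].
- exact: vintegrable_local_energy.
- exact: iw.
- by move=> x; rewrite mulr_ge0 ?bump_ge0 ?sqn_ge0.
- by move=> x; exact: sqn_ge0.
- move=> x; rewrite exprMn -mulrA; apply: ler_pM; rewrite ?sqr_ge0//.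
    exact: le1_sqr (bump_ge0 _ _) (bump_le1 _ _).
  exact: sqn_dot.
by rewrite (le_trans (norm_le_sqrt H))// sqrtrM// local_energy_ge0.
Qed.

(** * The rate of the local energy at a fixed time *)

Section fixed_time.
Variables (nu M : R) (u dtu F : V -> V) (p : V -> R).
Hypothesis nu0 : 0 <= nu.
Hypothesis M0 : 0 <= M.
Hypothesis cu : forall i, C2 (component u i).
Hypothesis divu : forall x, divergence u x = 0.
Hypothesis ca : forall i, C1 (component (advect u) i).
Hypothesis cF : forall i, C1 (component F i).
Hypothesis cp : C2 p.
Hypothesis lap_p : forall x, - laplacian p x = divergence (fun x => advect u x - F x) x.
Hypothesis eqn : forall x,
  dtu x = nu *: vlaplacian u x - (advect u x - F x + grad p x).
Hypothesis uM : forall x, sqn (u x) <= M ^+ 2.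
Hypothesis iG : vintegrable (grad_sqn u).
Hypothesis iF : vintegrable (fun x => sqn (F x)).
Hypothesis iq : vintegrable (fun x => sqn (grad p x)).

(** What differentiation under the integral gives for [local_energy r] when [dtu] is the time
    derivative of [u]; see [is_derive_local_energy]. *)
Definition energy_rate r := vint (fun x => bump r x * (2 * \sum_i u x 0 i * dtu x 0 i)).

Let cu1 i : C1 (component u i). Proof. exact: (cu i).1. Qed.
Let cu0 i : continuous (component u i). Proof. exact: C1_continuous. Qed.
Let v x := advect u x - F x.
Let w x := v x + grad p x.

Let cv i : C1 (component v i).
Proof.
rewrite (_ : component v i = fun x => component (advect u) i x - component F i x).
  by apply: C1B; [exact: ca|exact: cF].
by apply/funext => y; rewrite /component !mxE.
Qed.

Let iv : vintegrable (fun x => sqn (v x)).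
Proof.
have [ia _] := advect_bound M0 uM ca iG.
by have [] := vintegrable_sqnB (fun i => C1_continuous (ca i))
  (fun i => C1_continuous (cF i)) ia iF.
Qed.

Let ic r g : 0 < r -> continuous g -> vintegrable (fun x => bump r x * g x).
Proof.
move=> r0 cg; apply: (@vintegrable_compact _ _ r); last exact/vanishesMl/bump_vanishes.
by apply: continuousMf => //; exact: C1_continuous (C1_bump r).
Qed.

Let cdot w' : (forall i, continuous (component w' i)) ->
  continuous (fun x => \sum_i u x 0 i * w' x 0 i).
Proof.
by move=> cw; apply: continuous_sumf => i; apply: continuousMf; [exact: cu0|exact: cw].
Qed.

Let clap : continuous (fun x => \sum_i u x 0 i * laplacian (component u i) x).
Proof.
apply: continuous_sumf => i; apply: continuousMf; first exact: cu0.
by apply: continuous_sumf => j; exact: ((cu i).2 j).2.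
Qed.

Let cw i : C1 (component w i).
Proof. by have [] := Leray_projection cv cp lap_p iv iq. Qed.

Lemma energy_rateE r : 0 < r -> energy_rate r =
  2 * nu * vint (fun x => bump r x * \sum_i u x 0 i * laplacian (component u i) x) -
  2 * vint (fun x => bump r x * \sum_i u x 0 i * w x 0 i).
Proof.
move=> r0; have i1 := ic r0 clap.
have i2 := ic r0 (cdot (fun i => C1_continuous (cw i))).
rewrite -(vintZ _ i1) -(vintZ _ i2) -(vintB (vintegrableZ _ i1) (vintegrableZ _ i2)).
apply: eq_vint => x; rewrite [RHS](_ : _ = bump r x *
  (2 * (nu * (\sum_i u x 0 i * laplacian (component u i) x) - \sum_i u x 0 i * w x 0 i))); last by ring.
congr (_ * (_ * _)); rewrite mulr_sumr -sumrB; apply: eq_bigr => i _.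
by rewrite eqn /w /v !mxE; ring.
Qed.

(** The rate of the first pass. The pressure is not separated from the other terms: [w] as a whole
    is bounded by the contraction, which requires no global integrability of [u]. The condition
    [1 <= r] turns [4 / r] into 4. *)
Lemma energy_rate_le r : 1 <= r -> energy_rate r <= 2 * Num.sqrt (local_energy r u) *
  ((4 * nu + M) * Num.sqrt (vint (grad_sqn u)) + Num.sqrt (vint (fun x => sqn (F x)))).
Proof.
move=> r1; have r0 : 0 < r by exact: lt_le_trans r1.
rewrite energy_rateE//.
have H1 := viscous_bound r0 cu iG.
have [_ _ iw Hw] := Leray_projection cv cp lap_p iv iq.
have H2 := weighted_dot_bound r0 cu0 (fun i => C1_continuous (cw i)) iw.
have [ia Ha] := advect_bound M0 uM ca iG.
have H3 := sqrt_vint_sqnB (fun i => C1_continuous (ca i))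
  (fun i => C1_continuous (cF i)) ia iF.
have Hw' : Num.sqrt (vint (fun x => sqn (w x))) <= Num.sqrt (vint (fun x => sqn (v x))).
  exact: ler_wsqrtr.
move: H1 H2 H3 Hw' Ha; rewrite -/w -/v.
move: (vint _) (vint (fun x => bump r x * \sum_i u x 0 i * w x 0 i)) => X Y.
have := sqrtr_ge0 (local_energy r u); move: (Num.sqrt (local_energy r u)) => e e0.
have := sqrtr_ge0 (vint (grad_sqn u)); move: (Num.sqrt (vint (grad_sqn u))) => G G0.
move: (Num.sqrt (vint (fun x => sqn (w x)))) (Num.sqrt (vint (fun x => sqn (v x)))).
move: (Num.sqrt (vint (fun x => sqn (F x)))) (Num.sqrt (vint (fun x => sqn (advect u x)))).
move=> sF sa sw sv H1 H2 H3 Hw' Ha.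
have H1' : X <= 4 * (e * G).
  apply: (le_trans H1); apply: ler_wpM2r; first exact: mulr_ge0.
  by rewrite ler_pdivrMr// ler_peMr.
have H4 : nu * X <= nu * (4 * (e * G)) by apply: ler_wpM2l.
have H5 : - Y <= e * (M * G + sF).
  apply: (@le_trans _ _ (e * sw)).
    by rewrite (le_trans _ H2)// -normrN ler_norm.
  by apply: ler_wpM2l => //; rewrite (le_trans Hw')// (le_trans H3)// lerD2r.
nra.
Qed.

(** Pointwise, [u . (u . grad u)] is half of [u . grad |u|^2]; then [vint_transport] moves the
    derivative to the cutoff. *)
Lemma advect_transport r : 0 < r ->
  vint (fun x => bump r x * \sum_i u x 0 i * advect u x 0 i) =
  - (2^-1 * vint (fun x => (\sum_j u x 0 j * partial j (bump r) x) * sqn (u x))).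
Proof.
move=> r0.
have csq : C1 (fun x => sqn (u x)).
  rewrite /sqn; suff : C1 (fun x => \sum_(i <- index_enum 'I_d) component u i x ^+ 2) by [].
  elim: (index_enum _) => [|i s IH].
    under eq_fun do rewrite big_nil.
    split=> [x|j]; first exact: differentiable_cst.
    rewrite (_ : partial j _ = fun=> 0); first exact: cst_continuous.
    by apply/funext => x; exact: derive_cst.
  by under eq_fun do rewrite big_cons expr2; apply: C1D => //; exact: C1M.
have dsq j x : partial j (fun x => sqn (u x)) x =
    2 * \sum_i u x 0 i * partial j (component u i) x.
  rewrite /partial (_ : (fun x => sqn (u x)) = \sum_(i < d) (fun x => component u i x * component u i x)); last first.
    by apply/funext => y; rewrite fct_sumE; apply: eq_bigr => i _; rewrite expr2.
  rewrite derive_sum; last first.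
    by move=> i; apply: C1_derivable; exact: C1M.
  rewrite mulr_sumr; apply: eq_bigr => i _.
  rewrite -/(partial j (fun x => component u i x * component u i x) x).
  by rewrite (partialM _ (cu1 i).1 (cu1 i).1) -/(partial j (component u i) x) /component; ring.
have H := vint_transport (C1_bump r) csq (bump_vanishes r0) cu1 divu.
rewrite -mulrN -H -vintZ; last first.
  apply: ic => //; apply: continuous_sumf => j.
  by apply: continuousMf; [exact: cu0|exact: csq.2].
apply: eq_vint => x; rewrite mulrCA; congr (_ * _).
under [in RHS]eq_bigr => j _ do rewrite dsq.
have -> : 2^-1 * (\sum_j u x 0 j * (2 * \sum_i u x 0 i * partial j (component u i) x)) =
    \sum_j u x 0 j * \sum_i u x 0 i * partial j (component u i) x.
  by rewrite mulr_sumr; apply: eq_bigr => j _; field.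
under eq_bigr => i _ do rewrite mxE mulr_sumr.
rewrite exchange_big/=; apply: eq_bigr => j _; rewrite mulr_sumr.
by apply: eq_bigr => i _; rewrite mulrCA.
Qed.

(** The constant is one half of [|grad (bump r)| <= 4 / r]. Of the three factors [u], one is bounded
    by [M] and two make the energy. *)
Lemma advect_transport_le r : 0 < r -> vintegrable (fun x => sqn (u x)) ->
  `|vint (fun x => bump r x * \sum_i u x 0 i * advect u x 0 i)| <=
  2 / r * M * vint (fun x => sqn (u x)).
Proof.
move=> r0 iu; rewrite advect_transport// normrN normrM.
rewrite (_ : 2 / r * M * _ = `|2^-1| * (4 / r * M * vint (fun x => sqn (u x)))); last first.
  rewrite ger0_norm ?invr_ge0//; field; exact: lt0r_neq0.
apply: ler_wpM2l; first exact: normr_ge0.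
have cm : continuous (fun x => \sum_j u x 0 j * partial j (bump r) x).
  by apply: continuous_sumf => j; apply: continuousMf; [exact: cu0|exact: (C1_bump r).2].
have im : vintegrable (fun x => (\sum_j u x 0 j * partial j (bump r) x) * sqn (u x)).
  apply: (@vintegrable_compact _ _ r).
    by apply: continuousMf => //; exact: continuous_sqnf.
  apply: vanishesMl; apply: vanishes_sum => j.
  by apply/vanishesMr/partial_vanishes/bump_vanishes.
rewrite (le_trans (le_norm_vint im))// -(vintZ _ iu).
apply: (le_vint (vintegrable_norm im) (vintegrableZ _ iu)) => x.
rewrite normrM (ger0_norm (sqn_ge0 _)); apply: ler_wpM2r; first exact: sqn_ge0.
have k0 : 0 <= 4 / r * M by rewrite mulr_ge0// divr_ge0// ltW.
rewrite -[leRHS](ger0_norm k0) -(sqrtr_sqr (4 / r * M)); apply: norm_le_sqrt.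
apply: (le_trans (sum_Cauchy_Schwarz _ _)).
rewrite (_ : (4 / r * M) ^+ 2 = M ^+ 2 * (16 / r ^+ 2)); last by field; exact: lt0r_neq0.
apply: ler_pM.
- exact: sqn_ge0.
- by apply: sumr_ge0 => j _; exact: sqr_ge0.
- exact: uM.
- rewrite (le_trans (sum_sqr_partial_bump _ r0))// ler_piMr ?bump_le1//.
  by rewrite divr_ge0// ltW// exprn_gt0.
Qed.

(** The rate of the second pass. Now that [u] is square integrable, [w] is split into its three
    terms: transport is of order [1 / r], the gradient is orthogonal to [u] in the limit, and [F]
    alone remains. *)
Lemma energy_rate_cvg : vintegrable (fun x => sqn (u x)) ->
  exists2 e : nat -> R, e @ \oo --> (0 : R) & forall n,
  energy_rate n.+1%:R <= 2 * Num.sqrt (local_energy n.+1%:R u) *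
     Num.sqrt (vint (fun x => sqn (F x))) + e n.
Proof.
move=> iu.
have cg i : C1 (component (grad p) i) by exact: C1_component_grad.
pose K := Num.sqrt (vint (fun x => sqn (u x))) * Num.sqrt (vint (grad_sqn u)).
pose Z n := vint (fun x => bump n.+1%:R x * \sum_i u x 0 i * grad p x 0 i).
(* The viscous and transport errors, of order [1 / r], and the pairing [Z n] with the pressure
   gradient, which tends to 0 without a rate. *)
exists (fun n => n.+1%:R^-1 * (8 * nu * K + 4 * M * vint (fun x => sqn (u x))) + 2 * `|Z n|).
  have Z0 : Z n @[n --> \oo] --> (0 : R).
    have iq' : vintegrable (fun x => \sum_j partial j p x ^+ 2).
      move: iq; rewrite (_ : (fun x => sqn (grad p x)) = (fun x => \sum_j partial j p x ^+ 2))//.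
      by apply/funext => x; apply: eq_bigr => i _; rewrite mxE.
    have [io o] := orthogonal_gradient cu1 divu cp iu iq'.
    rewrite -o.
    have E x : \sum_i u x 0 i * grad p x 0 i = \sum_i u x 0 i * partial i p x.
      by apply: eq_bigr => i _; rewrite mxE.
    have [||||//] := @vint_dominated R d
      (fun n x => bump n.+1%:R x * \sum_i u x 0 i * grad p x 0 i)
      (fun x => \sum_i u x 0 i * partial i p x)
      (fun x => `|\sum_i u x 0 i * partial i p x|).
    - move=> n; apply: continuous_vmeasurable; apply: continuousMf.
        exact: C1_continuous (C1_bump _).
      by apply: cdot => i; exact: C1_continuous.
    - exact: vintegrable_norm.
    - move=> n x; rewrite E normrM ler_piMl// ger0_norm ?bump_ge0//.
      exact: bump_le1.
    - move=> x; rewrite E -[X in _ --> X]mul1r; apply: cvgM; last exact: cvg_cst.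
      exact: bump_cvg.
  rewrite (_ : nbhs (0 : R) = nbhs (0 * (8 * nu * K + 4 * M * vint (fun x => sqn (u x))) + 2 * `|0 : R|)); last first.
    by rewrite normr0 mulr0 mul0r addr0.
  apply: cvgD.
    by apply: cvgM; [exact: cvg_harmonic|exact: cvg_cst].
  by apply: cvgM; [exact: cvg_cst|exact: cvg_norm].
move=> n; set r : R := n.+1%:R; have r0 : 0 < r by rewrite ltr0Sn.
rewrite energy_rateE//.
have i1 := ic r0 (cdot (fun i => C1_continuous (ca i))).
have i2 := ic r0 (cdot (fun i => C1_continuous (cF i))).
have i3 := ic r0 (cdot (fun i => C1_continuous (cg i))).
have -> : vint (fun x => bump r x * \sum_i u x 0 i * w x 0 i) =
    vint (fun x => bump r x * \sum_i u x 0 i * advect u x 0 i) -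
    vint (fun x => bump r x * \sum_i u x 0 i * F x 0 i) + Z n.
  rewrite -(vintB i1 i2) -(vintD (vintegrableB i1 i2) i3).
  apply: eq_vint => x; rewrite -mulrBr -mulrDr; congr (_ * _).
  rewrite -sumrB -big_split/=; apply: eq_bigr => i _.
  by rewrite /w /v !mxE; ring.
have H1 := viscous_bound r0 cu iG.
have H2 := weighted_dot_bound r0 cu0 (fun i => C1_continuous (cF i)) iF.
have H3 := advect_transport_le r0 iu.
have H4 : Num.sqrt (local_energy r u) <= Num.sqrt (vint (fun x => sqn (u x))).
  apply: ler_wsqrtr; apply: (le_vint (vintegrable_local_energy r0 cu0) iu) => x.
  by rewrite ler_piMl ?sqn_ge0// bump_le1.
have H1' : vint (fun x => bump r x * \sum_i u x 0 i * laplacian (component u i) x) <=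
    4 / r * K.
  apply: (le_trans H1); apply: ler_wpM2l; first by rewrite divr_ge0// ltW.
  by apply: ler_wpM2r => //; exact: sqrtr_ge0.
move: H1' H2 H3; move: (Num.sqrt (local_energy r u)) => e.
move: (Num.sqrt (vint (fun x => sqn (F x)))) => sF.
move: (vint _) (vint _) (vint _) (vint _) (Z n) => X1 X2 X3 X4 z.
move=> H1' H2 H3.
have H5 := ler_wpM2l nu0 H1'.
have H6 : - X2 <= 2 / r * M * X1 by rewrite (le_trans _ H3)// -normrN ler_norm.
have H7 : X3 <= e * sF by rewrite (le_trans _ H2)// ler_norm.
have H8 : - z <= `|z| by rewrite -normrN ler_norm.
have -> : r^-1 * (8 * nu * K + 4 * M * X1) = 2 * (nu * (4 / r * K)) + 2 * (2 / r * M * X1) by ring.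
have -> : 2 * nu * X4 = 2 * (nu * X4) by ring.
have -> : 2 * e * sF = 2 * (e * sF) by ring.
(* With the products replaced by variables the inequality becomes linear. *)
have key (a b c' d' e' x y z' : R) : a <= b -> - x <= c' -> y <= d' -> - z' <= e' ->
  2 * a - 2 * (x - y + z') <= 2 * d' + (2 * b + 2 * c' + 2 * e') by lra.
exact: key.
Qed.

End fixed_time.
End energy.

(** * Growth of the square root of an energy *)

Section growth.
Context {R : realType}.
Local Notation leb := (@lebesgue_measure R).

Section fixed.
Variables (T eta : R) (E D F : R -> R).
Hypothesis eta0 : 0 < eta.
Hypothesis cE : continuous E.
Hypothesis E0 : forall t, 0 <= E t.
Hypothesis dE : forall t, t \in `]0, T[ -> is_derive t 1 E (D t).
Hypothesis cD : forall t, t \in `]0, T[ -> {for t, continuous D}.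

(** The derivative of [sqrt (E + eta)], continuous because [eta] keeps the root away from 0. *)
Definition sqrt_rate t := D t / (2 * Num.sqrt (E t + eta)).

(* The part of the growth rate of [sqrt (E + eta)] that [F] does not account
   for. *)
Definition excess t := Num.max 0 (sqrt_rate t - F t).

Let H t := Num.sqrt (E t + eta).

Let Eeta t : 0 < E t + eta. Proof. by rewrite ltr_wpDl. Qed.

Let cH : continuous H.
Proof.
move=> t; apply: (@continuous_comp _ _ _ (fun t => E t + eta) Num.sqrt).
  by apply: cvgD; [exact: cE|exact: cvg_cst].
exact: sqrt_continuous.
Qed.

Let dH t : t \in `]0, T[ -> is_derive t 1 H (sqrt_rate t).
Proof.
move=> tT; have dEt := dE tT.
have dE' : is_derive t 1 (fun t => E t + eta) (D t).
  apply: (is_derive_eq (@is_deriveD _ _ _ E (cst eta) t 1 _ _ dEt (is_derive_cst _ _ _))).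
  by rewrite addr0.
apply: (is_derive_eq (@is_derive1_comp _ Num.sqrt (fun t => E t + eta) t _ _
  (is_derive1_sqrt (Eeta t)) dE')).
by rewrite /sqrt_rate mulrC.
Qed.

Let c_rate t : t \in `]0, T[ -> {for t, continuous sqrt_rate}.
Proof.
move=> tT; apply: cvgM; first exact: cD.
apply: cvgV; first by rewrite gt_eqF// mulr_gt0// sqrtr_gt0.
by apply: cvgM; [exact: cvg_cst|exact: cH].
Qed.

Hypothesis mF : measurable_fun `]0, T[ F.

Lemma measurable_excess : measurable_fun `]0, T[ excess.
Proof.
apply: measurable_maxr => //; apply: measurable_funB => //.
apply: open_continuous_measurable_fun; first exact: interval_open.
by move=> t; rewrite inE => tT; exact: c_rate.
Qed.

Hypothesis F0 : forall t, 0 <= F t.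
Hypothesis iF : leb.-integrable `]0, T[ (EFin \o F).
Hypothesis iX : leb.-integrable `]0, T[ (EFin \o excess).

Let X0 t : 0 <= excess t. Proof. by rewrite le_max lexx. Qed.

Let I := \int[leb]_(t in `]0, T[) F t + \int[leb]_(t in `]0, T[) excess t.

(** The fundamental theorem is applied to the continuous [sqrt_rate]. It is at most [F + excess]
    everywhere, by the definition of [excess], so [F] itself needs no continuity. *)
Let growth_oo a b : 0 < a -> a < b -> b < T -> H b <= H a + I.
Proof.
move=> a0 ab bT.
have sub t : t \in `[a, b] -> t \in `]0, T[.
  by rewrite !in_itv/= => /andP[? ?]; apply/andP; split; lra.
have subset : `[a, b] `<=` `]0, T[ by move=> t; exact: sub.
have cr : {within `[a, b], continuous sqrt_rate}.
  by apply: continuous_in_subspaceT => t; rewrite inE => /sub; exact: c_rate.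
have iFX : leb.-integrable `]0, T[ (EFin \o (fun t => F t + excess t)).
  exact: (integrableD _ iF iX).
have FTC : (\int[leb]_(t in `[a, b]) (sqrt_rate t)%:E = (H b)%:E - (H a)%:E)%E.
  apply: continuous_FTC2 => //.
    split=> [t tab||].
    - by have [] := dH (sub _ (subset_itv_oo_cc tab)).
    - exact/cvg_at_right_filter/cH.
    - exact/cvg_at_left_filter/cH.
  move=> t tab; have dHt := dH (sub _ (subset_itv_oo_cc tab)).
  by rewrite derive1E derive_val.
have H1 : (\int[leb]_(t in `[a, b]) (sqrt_rate t)%:E <=
    \int[leb]_(t in `[a, b]) (F t + excess t)%:E)%E.
  apply: le_integral => //.
  - by apply: continuous_compact_integrable => //; exact: segment_compact.
  - by apply: (@integrableS _ _ _ leb `]0, T[%classic `[a, b]%classic).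
  - by move=> t _; rewrite lee_fin -lerBlDl le_max lexx orbT.
have H2 : (\int[leb]_(t in `[a, b]) (F t + excess t)%:E <=
    \int[leb]_(t in `]0%R, T[) (F t + excess t)%:E)%E.
  apply: ge0_subset_integral => //.
  - exact: measurable_int iFX.
  - by move=> t _; rewrite lee_fin addr_ge0.
have H3 : (\int[leb]_(t in `]0%R, T[) (F t + excess t)%:E = I%:E)%E.
  rewrite /I -RintegralD// /Rintegral fineK//.
  exact: integrable_fin_num iFX.
rewrite -lerBlDl -lee_fin EFinB -FTC (le_trans H1)//.
by rewrite (le_trans H2)// H3.
Qed.

(** The derivative is known only inside the interval; its ends are reached by continuity of [E]. *)
Lemma sqrt_growth s : 0 < s <= T -> H s <= H 0 + I.
Proof.
move=> /andP[s0 sT].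
have step b : 0 < b -> b < T -> H b <= H 0 + I.
  move=> b0 bT.
  have C : H a + I @[a --> 0^'+] --> H 0 + I.
    apply: cvgD; last exact: cvg_cst.
    exact/cvg_at_right_filter/cH.
  apply: (cvgr_to_ge C); near=> a; apply: growth_oo => //.
have C : H b @[b --> s^'-] --> H s by exact/cvg_at_left_filter/cH.
apply: (cvgr_to_le C); near=> b; apply: step.
  by near: b; exact: nbhs_left_gt.
by apply: lt_le_trans sT; near: b; exact: nbhs_left_lt.
Unshelve. all: by end_near. Qed.

End fixed.
End growth.

(** * Norms *)

Section norms.
Context {R : realType} {d : nat}.
Local Notation V := 'rV[R]_d.
Local Notation RT := (measurableTypeR R).
Local Notation mu := (@lebesgue_tuple R d).

Lemma lebesgue_tuple_box_gt0 n (r : R) : 0 < r ->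
  (0 < lebesgue_tuple n [set t : n.-tuple RT | forall i, (tnth t i \in `[-r, r])%R])%E.
Proof.
move=> r0; elim: n => [|n IH].
  by rewrite /= diracE mem_set// => -[].
rewrite /= /cons_measure /pushforward.
rewrite (_ : consT (n:=n) @^-1` _ = `[-r, r]%classic `*`
    [set t : n.-tuple RT | forall i, tnth t i \in `[-r, r]]); last first.
  apply/seteqP; split=> -[x t] /=.
    move=> h; split; first by have := h ord0; rewrite tnth0.
    by move=> i; have := h (lift ord0 i); rewrite tnthS.
  move=> [hx ht] i; case: (unliftP ord0 i) => [j|] -> /=; last by rewrite tnth0.
  by rewrite tnthS.
rewrite product_measure1E//; last exact: measurable_box.
apply: mule_gt0; last exact: IH.
rewrite [X in (_ < X)%E]lebesgue_measure_itv/= lte_fin ifT; last by lra.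
by rewrite -EFinB lte_fin; lra.
Qed.

Lemma lebesgue_tuple_ball_gt0 (x : V) (r : R) : 0 < r ->
  (0 < mu [set t | (`|row_of_tuple t - x| <= r)%R])%E.
Proof.
move=> r0; rewrite (_ : [set _ | _] = shiftT (- x) @^-1` vbox r); last first.
  by apply/seteqP; split=> t /=; rewrite -row_shiftT => /(vbox_normr _ (ltW r0)).
rewrite lebesgue_tuple_shift; first exact: lebesgue_tuple_box_gt0.
exact: measurable_box.
Qed.

(** A violation at one point would persist on a ball, and balls have positive measure. *)
Lemma ae_le_continuous (g : V -> R) (c : R) : continuous g ->
  {ae mu, forall t, g (row_of_tuple t) <= c} -> forall x, g x <= c.
Proof.
move=> cg gc x; rewrite leNgt; apply/negP => cx.
have : \forall y \near x, c < g y by exact: (cvgr_gt (g x) (cg x)).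
move=> /nbhs_ballP[e /= e0 eg].
have e20 : 0 < e / 2 by rewrite divr_gt0.
have := lebesgue_tuple_ball_gt0 x e20; rewrite lt0e => /andP[/negP + _]; apply.
have [N [mN N0 sN]] := gc.
apply/eqP/(subset_measure0 _ mN) => //.
  rewrite (_ : [set _ | _] = shiftT (- x) @^-1` vbox (e / 2)); last first.
    by apply/seteqP; split=> t /=; rewrite -row_shiftT => /(vbox_normr _ (ltW e20)).
  rewrite -[X in measurable X]setTI; apply: measurable_shiftT => //.
  exact: measurable_box.
move=> t /= tx; apply: sN => /=; apply/negP; rewrite -ltNge; apply: eg.
rewrite -ball_normE /ball_/= distrC (le_lt_trans tx)//; lra.
Qed.

Definition sumsq (I : finType) (a : I -> V -> R) x := \sum_i a i x ^+ 2.

Lemma sumsq_ge0 (I : finType) (a : I -> V -> R) x : 0 <= sumsq a x.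
Proof. by apply: sumr_ge0 => i _; exact: sqr_ge0. Qed.

Lemma normL2E (I : finType) (a : I -> V -> R) :
  normL 2%:E a = ((\int[mu]_t (sumsq a (row_of_tuple t))%:E) `^ 2^-1)%E.
Proof.
rewrite /normL unlock; congr (_ `^ _)%E; apply: eq_integral => t _ /=.
rewrite ger0_norm ?sqrtr_ge0// (powR_mulrn 2 (sqrtr_ge0 _)) sqr_sqrtr//.
exact: sumsq_ge0.
Qed.

Lemma normL2_integrable (I : finType) (a : I -> V -> R) :
  vintegrable (sumsq a) -> normL 2%:E a = (Num.sqrt (vint (sumsq a)))%:E.
Proof.
move=> ia; rewrite normL2E -[X in (X `^ _)%E]fineK; last exact: integrable_fin_num ia.
rewrite poweR_EFin powR12_sqrt// fine_ge0//.
by apply: integral_ge0 => t _; rewrite lee_fin sumsq_ge0.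
Qed.

Lemma normL2_lty (I : finType) (a : I -> V -> R) : vmeasurable (sumsq a) ->
  (normL 2%:E a < +oo)%E -> vintegrable (sumsq a).
Proof.
rewrite normL2E => ma /lty_poweRy; rewrite invr_eq0 pnatr_eq0 => /(_ isT) H.
apply/integrableP; split; first exact/measurable_EFinP.
by under eq_integral do rewrite gee0_abs ?lee_fin ?sumsq_ge0//.
Qed.

Lemma normLoo_le (I : finType) (a : I -> V -> R) (M : R) : 0 <= M ->
  (forall i, continuous (a i)) -> (normL +oo a <= M%:E)%E ->
  forall x, sumsq a x <= M ^+ 2.
Proof.
move=> M0 ca; rewrite /normL unlock.
(* The norm with exponent [+oo] is an essential supremum only over a space of positive measure. *)
have muT : (0 < mu setT)%E.
  apply: (lt_le_trans (lebesgue_tuple_ball_gt0 0 ltr01)).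
  apply: le_measure; rewrite ?inE//.
  rewrite (_ : [set _ | _] = vbox 1); first exact: measurable_box.
  by apply/seteqP; split=> t /=; rewrite subr0 => /(vbox_normr _ ler01).
rewrite muT => /ess_supP h x.
have c2 : continuous (sumsq a).
  by apply: continuous_sumf => i; apply: continuousXf; exact: ca.
apply: (ae_le_continuous c2); apply: filterS h => t /=.
rewrite lee_fin ger0_norm ?sqrtr_ge0// => h.
by rewrite -[leLHS]sqr_sqrtr ?sumsq_ge0// lerXn2r ?nnegrE ?sqrtr_ge0.
Qed.

Lemma normLooL_lty (T : R) (q : \bar R) (I : finType) (a : R -> I -> V -> R) :
  (normLooL T q a < +oo)%E -> exists2 M : R, 0 <= M &
  {ae lebesgue_measure, forall t, t \in `[0, T] -> (normL q (a t) <= M%:E)%E}.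
Proof.
rewrite /normLooL => H; set m := mrestr _ _ in H.
have [M M0 HM] : exists2 M : R, 0 <= M & (ess_sup m (fun t => normL q (a t)) <= M%:E)%E.
  move: H; case: (ess_sup _ _) => [r _|//|_]; last by exists 0; rewrite ?leNye.
  by exists (Num.max 0 r); rewrite ?lee_fin le_max lexx ?orbT.
exists M => //; have /ess_supP[N [mN N0 sN]] := HM.
(* A null set of the restricted measure is Lebesgue null after intersection with [[0, T]]. *)
exists (N `&` `[0, T]); split => //; first exact: measurableI.
move=> t /= /not_implyP[tT ht]; split => //.
by apply: sN => /=.
Qed.

(** Tonelli's theorem on the whole product, after extending the integrand by 0 outside [[0, T]]. *)
Lemma measurable_normL2 (T : R) (f : R -> V -> V) : measurable_field T f ->
  measurable_fun (`[0, T] : set RT) (fun t => normL 2%:E (component (f t))).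
Proof.
move=> mf; set A : set RT := `[0, T]%classic.
have mA : measurable A by exact: measurable_itv.
pose S (z : RT * d.-tuple RT) : \bar R := (sumsq (component (f z.1)) (row_of_tuple z.2))%:E.
have mAT : measurable (A `*` [set: d.-tuple RT]) by exact: measurableX.
have mS : measurable_fun (A `*` [set: d.-tuple RT]) S.
  apply/measurable_EFinP; rewrite /sumsq; apply: measurable_sum => i.
  by apply: measurable_funX; exact: mf.
have mS' : measurable_fun setT (S \_ (A `*` [set: d.-tuple RT])).
  exact: (measurable_restrictT S mAT).1.
have S0 z : (0 <= (S \_ (A `*` [set: d.-tuple RT])) z)%E.
  by rewrite /patch; case: ifP => // _; rewrite lee_fin sumsq_ge0.
have := measurable_fun_fubini_tonelli_F (m2 := mu) _ mS' S0.
rewrite /fubini_F => mI.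
have mP : measurable_fun setT (fun t : RT =>
    ((\int[mu]_y (S \_ (A `*` [set: d.-tuple RT])) (t, y)) `^ 2^-1)%E).
  exact: (measurableT_comp (measurable_poweR _) mI).
apply: (eq_measurable_fun _ _ (measurable_funTS mP)) => t /[!inE] At.
rewrite normL2E; congr (_ `^ _)%E; apply: eq_integral => y _.
by rewrite /patch mem_set.
Qed.

End norms.

(** * Evolution of the local energy *)

Section time_regularity.
Context {R : realType} {d : nat}.
Local Notation V := 'rV[R]_d.
Implicit Types (T t r : R) (u : R -> V -> V).

Lemma cvg_sumf (S : Type) (F : set_system S) (FF : Filter F) (I : Type) (s : seq I)
    (f : I -> S -> R) (l : I -> R) : (forall i, f i x @[x --> F] --> l i) ->
  \sum_(i <- s) f i x @[x --> F] --> \sum_(i <- s) l i.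
Proof.
move=> fl; elim: s => [|i s IH].
  by under eq_fun do rewrite big_nil; rewrite big_nil; exact: cvg_cst.
by under eq_fun do rewrite big_cons; rewrite big_cons; exact: cvgD.
Qed.

(* [u] is given on [[0, T]] only; composing with [clamp] makes the local energy
   continuous on the whole line. *)
Definition clamp T t : R := Num.max 0 (Num.min t T).

Lemma clamp_itv T t : 0 <= T -> clamp T t \in `[0, T].
Proof. by move=> T0; rewrite in_itv/= /clamp le_max lexx/= ge_max T0 ge_min lexx orbT. Qed.

Lemma clamp_id T t : t \in `[0, T] -> clamp T t = t.
Proof. by rewrite in_itv/= => /andP[t0 tT]; rewrite /clamp min_l// max_r. Qed.

Lemma continuous_clamp T : continuous (clamp T).
Proof.
move=> t; apply: (@continuous_max _ _ (cst 0 : R -> R) (fun t => Num.min t T)).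
  exact: cst_continuous.
by apply: (@continuous_min _ _ id (cst T : R -> R)); [exact: cvg_id|exact: cst_continuous].
Qed.

Lemma continuous_clamped T u (i : 'I_d) t x : 0 <= T ->
  {within `[0, T] `*` [set: V], continuous (fun z : R * V => u z.1 z.2)} ->
  {for (t, x), continuous (fun z : R * V => u (clamp T z.1) z.2 0 i)}.
Proof.
move=> T0 /subspace_continuousP cu.
have {cu} cu := cu (clamp T t, x) (conj (clamp_itv t T0) I).
apply: (@continuous_comp _ _ _ (fun z : R * V => u (clamp T z.1) z.2)
  (fun M : V => M 0 i)); last exact: coord_continuous.
apply: (@cvg_comp _ _ _ (fun z : R * V => (clamp T z.1, z.2)) (fun z => u z.1 z.2)
  _ _ _ _ cu).
have c1 : (clamp T z.1) @[z --> (t, x)] --> clamp T t.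
  by apply: (@cvg_comp _ _ _ fst (clamp T)); [exact: cvg_fst|exact: continuous_clamp].
have c2 : z.2 @[z --> (t, x)] --> x by exact: cvg_snd.
have c12 : (clamp T z.1, z.2) @[z --> (t, x)] --> (clamp T t, x).
  exact: (@cvg_pair _ _ _ (nbhs (t, x)) (nbhs (clamp T t)) (nbhs x) _ _ _
    (fun z : R * V => clamp T z.1) (fun z : R * V => z.2) c1 c2).
move=> P; rewrite /within/= => HP.
have := c12 _ HP; rewrite !nbhs_simpl/=; apply: filterS => z; apply.
by split => //=; exact: clamp_itv.
Qed.

Definition time_derivative u t : V -> V := fun x => derive1 (u ^~ x) t.

Lemma continuous_local_energy r T u : 0 < r -> 0 <= T ->
  {within `[0, T] `*` [set: V], continuous (fun z : R * V => u z.1 z.2)} ->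
  continuous (fun t => local_energy r (u (clamp T t))).
Proof.
move=> r0 T0 cu t.
apply: (@vint_continuous R d (t - 1) (t + 1) r
  (fun t x => bump r x * sqn (u (clamp T t) x))).
- move=> s x _; apply: (@cvgM _ _ _ _ (fun z : R * V => bump r z.2)).
    apply: (@continuous_comp _ _ _ (snd : R * V -> V)); first exact: cvg_snd.
    exact: (C1_continuous (C1_bump r)).
  apply: (@cvg_sumf _ _ _ _ _ (fun i (z : R * V) => u (clamp T z.1) z.2 0 i ^+ 2)) => i.
  by apply: (@cvgM _ _ _ _ (fun z : R * V => u (clamp T z.1) z.2 0 i)
    (fun z : R * V => u (clamp T z.1) z.2 0 i)); exact: continuous_clamped.
- by move=> s _; apply/vanishesMl/bump_vanishes.
- by rewrite in_itv/=; apply/andP; split; lra.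
Qed.

Lemma is_derive_coord u t x (i : 'I_d) : derivable (u ^~ x) t 1 ->
  is_derive t 1 (fun s => u s x 0 i) (time_derivative u t x 0 i).
Proof.
move=> du; apply: DeriveDef; first exact: (derivable_mxP _ _ _).1.
by rewrite /time_derivative derive1E derive_mx// mxE.
Qed.

Lemma is_derive_local_energy r T u : 0 < r -> 0 < T -> classical T u ->
  forall t, t \in `]0, T[ ->
  is_derive t 1 (fun t => local_energy r (u (clamp T t)))
    (energy_rate (u t) (time_derivative u t) r) /\
  {for t, continuous (fun t => energy_rate (u t) (time_derivative u t) r)}.
Proof.
move=> r0 T0 [cu [du cdu] c2 _ _] t tT.
have itvE s : s \in `]0, T[ -> 0 < s < T by rewrite in_itv.
have sub s : s \in `]0, T[ -> s \in `[0, T] by exact: subset_itv_oo_cc.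
have cphi : continuous (fun z : R * V => bump r z.2).
  move=> z; apply: (@continuous_comp _ _ _ (snd : R * V -> V)); first exact: cvg_snd.
  exact: (C1_continuous (C1_bump r)).
have cui s x i : s \in `]0, T[ -> {for (s, x), continuous (fun z : R * V => u z.1 z.2 0 i)}.
  move=> sT; have := continuous_clamped (t := s) (x := x) (i := i) (ltW T0) cu.
  rewrite /prop_for /continuous_at/= clamp_id; last exact: sub.
  apply: cvg_trans; apply: near_eq_cvg.
  have : \forall z \near (s, x), z.1 \in `]0, T[.
    have := near_in_itvoo sT; exact: cvg_fst.
  by apply: filterS => z zT; rewrite clamp_id//; exact: sub.
have oQ : open (`]0, T[%classic `*` [set: V]).
  rewrite (_ : _ `*` _ = (fst : R * V -> R) @^-1` `]0, T[).
    apply: open_comp; last exact: interval_open.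
    by move=> z _; exact: cvg_fst.
  by apply/seteqP; split=> z /= => [[]|].
have cdi s x i : s \in `]0, T[ ->
    {for (s, x), continuous (fun z : R * V => time_derivative u z.1 z.2 0 i)}.
  move=> sT; apply: (@continuous_comp _ _ _ (fun z : R * V => time_derivative u z.1 z.2)
    (fun M : V => M 0 i)); last exact: coord_continuous.
  by move: cdu; rewrite continuous_open_subspace//; apply; rewrite inE.
have [|||||D C] := @vint_derive R d 0 T r (fun t x => bump r x * sqn (u t x))
  (fun t x => bump r x * (2 * \sum_i u t x 0 i * time_derivative u t x 0 i)) _ _ _ _ t.
- move=> s sT; apply: continuousMf; first exact: C1_continuous (C1_bump r).
  by apply: continuous_sqnf => i; apply: C1_continuous; exact: (c2 _ _ (itvE _ sT)).1.
- by move=> s _; apply/vanishesMl/bump_vanishes.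
- move=> s x sT.
  have di i : is_derive s 1 (fun s => u s x 0 i) (time_derivative u s x 0 i).
    by apply: is_derive_coord; exact: du (itvE _ sT).
  have ds : is_derive s 1 (fun s => sqn (u s x))
      (\sum_i (u s x 0 i *: time_derivative u s x 0 i + u s x 0 i *: time_derivative u s x 0 i)).
    rewrite (_ : (fun s => sqn (u s x)) = \sum_(i < d) (fun s => u s x 0 i * u s x 0 i)); last first.
      by apply/funext => z; rewrite fct_sumE; apply: eq_bigr => i _; rewrite expr2.
    by apply: is_derive_sum => i; exact: is_deriveM.
  apply: (is_derive_eq (@is_deriveM _ _ (cst (bump r x)) _ s 1 0 _ (is_derive_cst _ _ _) ds)).
  rewrite scaler0 addr0; congr (_ * _); rewrite mulr_sumr.
  by apply: eq_bigr => i _; rewrite -mulr2n mulr_natl.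
- move=> s x sT; apply: (@cvgM _ _ _ _ (fun z : R * V => bump r z.2)); first exact: cphi.
  apply: cvgM; first exact: cvg_cst.
  apply: (@cvg_sumf _ _ _ _ _ (fun i (z : R * V) =>
    u z.1 z.2 0 i * time_derivative u z.1 z.2 0 i)) => i.
  by apply: cvgM; [exact: cui|exact: cdi].
- exact: tT.
split; last exact: C.
(* At an interior time, [clamp] is the identity on a neighbourhood. *)
apply: (near_eq_is_derive _ D); have := near_in_itvoo tT.
by apply: filterS => s sT; rewrite clamp_id//; exact: sub.
Qed.

Lemma cvg_local_energy u t : (forall i, continuous (component (u t) i)) ->
  vintegrable (fun x => sqn (u t x)) ->
  local_energy n.+1%:R (u t) @[n --> \oo] --> vint (fun x => sqn (u t x)).
Proof.
move=> cu iu.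
have [||||//] := @vint_dominated R d (fun n x => bump n.+1%:R x * sqn (u t x))
  (fun x => sqn (u t x)) (fun x => sqn (u t x)).
- move=> n; apply: continuous_vmeasurable; apply: continuousMf.
    exact: C1_continuous (C1_bump _).
  exact: continuous_sqnf.
- exact: iu.
- move=> n x; rewrite ger0_norm; last by apply: mulr_ge0; [exact: bump_ge0|exact: sqn_ge0].
  by rewrite ler_piMl ?sqn_ge0// bump_le1.
- move=> x; rewrite -[X in _ --> X]mul1r; apply: cvgM; last exact: cvg_cst.
  exact: bump_cvg.
Qed.

(** Fatou's lemma, along cutoffs that tend to 1 pointwise. *)
Lemma local_energy_bounded_integrable (v : V -> V) (K : R) :
  (forall i, continuous (component v i)) ->
  (forall n, local_energy n.+1%:R v <= K) -> vintegrable (fun x => sqn (v x)).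
Proof.
move=> cv vK.
have c2 : continuous (fun x => sqn (v x)) := continuous_sqnf cv.
pose g n (t : d.-tuple (measurableTypeR R)) : \bar R :=
  (bump n.+1%:R (row_of_tuple t) * sqn (v (row_of_tuple t)))%:E.
have g0 n (t : d.-tuple (measurableTypeR R)) :
    [set: d.-tuple (measurableTypeR R)] t -> (0 <= g n t)%E.
  by move=> _; rewrite lee_fin; apply: mulr_ge0; [exact: bump_ge0|exact: sqn_ge0].
have mg n : measurable_fun setT (g n).
  apply/measurable_EFinP; apply: (@continuous_vmeasurable R d
    (fun x => bump n.+1%:R x * sqn (v x))).
  by apply: continuousMf => //; exact: C1_continuous (C1_bump _).
have gcvg (t : d.-tuple (measurableTypeR R)) :
    g n t @[n --> \oo] --> (sqn (v (row_of_tuple t)))%:E.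
  apply: cvg_EFin; first exact: nearW.
  rewrite -[X in _ --> X]mul1r; apply: (@cvgM _ _ _ _ (fun n => bump n.+1%:R _)).
    exact: bump_cvg.
  exact: cvg_cst.
have IK n : (\int[@lebesgue_tuple R d]_t g n t <= K%:E)%E.
  have ign := vintegrable_local_energy (ltr0Sn R n) cv.
  rewrite -[leLHS]fineK; last exact: integrable_fin_num ign.
  by rewrite lee_fin; exact: vK.
apply/integrableP; split.
  by apply/measurable_EFinP; exact: (continuous_vmeasurable c2).
apply: (@le_lt_trans _ _ K%:E); last exact: ltry.
have gE (t : d.-tuple (measurableTypeR R)) :
    limn_einf (g ^~ t) = (sqn (v (row_of_tuple t)))%:E.
  by rewrite (is_cvg_limn_einfE (cvgP _ (gcvg t))) (cvg_lim _ (gcvg t)).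
have := fatou (@lebesgue_tuple R d) measurableT mg g0.
under eq_integral do rewrite gE.
under [X in (_ -> X <= _)%E]eq_integral do rewrite gee0_abs ?lee_fin ?sqn_ge0//.
move=> H; apply: (le_trans H).
rewrite limn_einf_lim; apply: lime_le; first exact: is_cvg_einfs.
apply: nearW => n; apply: (le_trans _ (IK n)).
by apply: ereal_inf_lbound; exists n => /=.
Qed.

End time_regularity.

(** * The pressure behind the Leray projections *)

Section pressure.
Context {R : realType} {d : nat}.
Local Notation V := 'rV[R]_d.

Lemma C2B (p q : V -> R) : C2 p -> C2 q -> C2 (fun x => p x - q x).
Proof.
move=> [cp cp'] [cq cq']; split; first exact: C1B.
by move=> j; rewrite (partialB _ cp.1 cq.1); exact: C1B.
Qed.

Lemma gradB (p q : V -> R) x : C2 p -> C2 q ->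
  grad (fun x => p x - q x) x = grad p x - grad q x.
Proof.
move=> [cp _] [cq _]; apply/rowP => j; rewrite !mxE.
by rewrite (partialB _ cp.1 cq.1).
Qed.

Lemma laplacianB (p q : V -> R) x : C2 p -> C2 q ->
  laplacian (fun x => p x - q x) x = laplacian p x - laplacian q x.
Proof.
move=> [cp cp'] [cq cq']; rewrite /laplacian -sumrB; apply: eq_bigr => j _.
by rewrite (partialB _ cp.1 cq.1) (partialB _ (cp' j).1 (cq' j).1).
Qed.

Lemma divergenceB (v w : V -> V) x : (forall i, C1 (component v i)) ->
  (forall i, C1 (component w i)) ->
  divergence (fun x => v x - w x) x = divergence v x - divergence w x.
Proof.
move=> cv cw; rewrite /divergence -sumrB; apply: eq_bigr => i _.
rewrite (_ : component (fun x => v x - w x) i =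
    fun x => component v i x - component w i x); last first.
  by apply/funext => y; rewrite /component !mxE.
by rewrite (partialB _ (cv i).1 (cw i).1).
Qed.

Lemma LerayE (v : V -> V) : Leray_dom v -> exists p, [/\ C2 p,
  (forall x, - laplacian p x = divergence v x),
  vintegrable (fun x => sqn (grad p x)) &
  forall x, Leray v x = v x + grad p x].
Proof.
move=> [cv [q qS]]; exists (inv_opp_laplacian (divergence v)).
(* A solution exists by [Leray_dom], so [xget] does not return its default value. *)
have [cp lp ip] : inv_opp_laplacian_set (divergence v) (inv_opp_laplacian (divergence v)).
  by apply: xgetPex; exists q.
split=> // [|x]; last by rewrite /Leray /Xi opprK.
apply: (normL2_lty (a := component (grad (inv_opp_laplacian (divergence v))))) => //.
apply: continuous_vmeasurable; apply: continuous_sqnf => i.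
exact/C1_continuous/C1_component_grad.
Qed.

(** The two projections of the equation are merged into one, with a single pressure for
    [advect v - F], to which [Leray_projection] applies. *)
Lemma pressure_exists (nu : R) (v dtv F : V -> V) :
  Leray_dom (advect v) -> Leray_dom F ->
  (forall x, dtv x + Leray (advect v) x = nu *: vlaplacian v x + Leray F x) ->
  exists p, [/\ C2 p,
    (forall x, - laplacian p x = divergence (fun x => advect v x - F x) x),
    (forall x, dtv x = nu *: vlaplacian v x - (advect v x - F x + grad p x)) &
    vintegrable (fun x => sqn (grad p x))].
Proof.
move=> da dF eqn.
have [pa [cpa lpa ipa La]] := LerayE da; have [pF [cpF lpF ipF LF]] := LerayE dF.
exists (fun x => pa x - pF x); split.
- exact: C2B.
- move=> x; rewrite laplacianB// opprB addrC.
  by rewrite (divergenceB x da.1 dF.1) -lpa -lpF opprK.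
- move=> x; have := eqn x; rewrite La LF gradB// => /eqP.
  rewrite eq_sym addrC -subr_eq => /eqP <-.
  by rewrite !opprD !opprK !addrA; apply/rowP => i; rewrite !mxE; ring.
- have [H _] := vintegrable_sqnB
    (fun i => C1_continuous (C1_component_grad i cpa))
    (fun i => C1_continuous (C1_component_grad i cpF)) ipa ipF.
  by under eq_fun do rewrite gradB//.
Qed.

End pressure.

Lemma ae_imp (R : realType) d (T : sigmaRingType d) (mu : {measure set T -> \bar R})
    (P Q : T -> Prop) : (forall t, P t -> Q t) ->
  {ae mu, forall t, P t} -> {ae mu, forall t, Q t}.
Proof. by move=> h; apply: filterS. Qed.

Lemma ae_and (R : realType) d (T : sigmaRingType d) (mu : {measure set T -> \bar R})
    (P Q : T -> Prop) : {ae mu, forall t, P t} -> {ae mu, forall t, Q t} ->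
  {ae mu, forall t, P t /\ Q t}.
Proof. by move=> hP hQ; apply: filterS2 hP hQ. Qed.

(** * The energy inequality *)

Section energy_inequality.
Context {R : realType} {d : nat}.
Local Notation V := 'rV[R]_d.
Local Notation leb := (@lebesgue_measure R).
Variables (nu T : R) (f u : R -> V -> V).
Hypothesis hnu : 0 < nu.
Hypothesis hT : 0 < T.
Hypothesis hf : measurable_field T f.
Hypothesis hu : classical T u.
Hypothesis hudiv : forall t, 0 < t < T -> divergence_free (u t).
Hypothesis hadv_dom : forall t, 0 < t < T -> Leray_dom (advect (u t)).
Hypothesis hf_dom : forall t, 0 < t < T -> Leray_dom (f t).
Hypothesis heq : forall t x, 0 < t < T ->
  derive1 (u ^~ x) t + Leray (advect (u t)) x
    = nu *: vlaplacian (u t) x + Leray (f t) x.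
Variables M G : R.
Hypothesis M0 : 0 <= M.
Hypothesis G0 : 0 <= G.
Hypothesis hM : {ae leb, forall t, t \in `[0, T] ->
  (normL +oo (component (u t)) <= M%:E)%E}.
Hypothesis hG : {ae leb, forall t, t \in `[0, T] ->
  (normL 2%:E (nabla (u t)) <= G%:E)%E}.
Hypothesis f_lty : (\int[leb]_(s in `[0%R, T]) normL 2%:E (component (f s)) < +oo)%E.
Hypothesis u0_lty : (normL 2%:E (component (u 0)) < +oo)%E.

(** Where the norm of [f t] is infinite this is 0. Such times form a null set once the integral of
    the norm is finite. *)
Let F t : R := fine (normL 2%:E (component (f t))).
Let E n t := local_energy n.+1%:R (u (clamp T t)).
Let D n t := energy_rate (u t) (time_derivative u t) n.+1%:R.
(** The constant of [energy_rate_le], with the norm of [nabla u] replaced by its bound [G]. *)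
Let C := (4 * nu + M) * G.

Let itvP t : t \in `]0, T[ -> 0 < t < T. Proof. by rewrite in_itv. Qed.

Let normL_ge0 (q : \bar R) (I : finType) (a : I -> V -> R) : (0 <= normL q a)%E.
Proof. exact: Lnorm_ge0. Qed.

Let F0 t : 0 <= F t. Proof. exact/fine_ge0/normL_ge0. Qed.

Let cu t : t \in `[0, T] -> forall i, continuous (component (u t) i).
Proof.
move=> tT i x; have [cu _ _ _ _] := hu.
have := @continuous_clamped R d T u i t x (ltW hT) cu.
by move=> /(joint_continuous_r (F := fun t x => u (clamp T t) x 0 i)); rewrite clamp_id.
Qed.

Let in0 : 0 \in `[0, T]. Proof. by rewrite in_itv/= lexx ltW. Qed.
Let inT : T \in `[0, T]. Proof. by rewrite in_itv/= lexx ltW. Qed.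

Let mF : measurable_fun `]0, T[ F.
Proof.
apply: (@measurable_funS _ _ _ _ `[0, T]%classic) => //; first exact: subset_itv_oo_cc.
by apply: (@measurableT_comp _ _ _ _ _ _ (@fine R)); [exact: fine_measurable|exact: (measurable_normL2 hf)].
Qed.

Let iFE : leb.-integrable `[0, T] (fun t => normL 2%:E (component (f t))).
Proof.
apply/integrableP; split; first exact: measurable_normL2.
by under eq_integral do rewrite gee0_abs//.
Qed.

Let F_le : (\int[leb]_(t in `]0%R, T[) (F t)%:E <=
  \int[leb]_(s in `[0%R, T]) normL 2%:E (component (f s)))%E.
Proof.
apply: (@le_trans _ _ (\int[leb]_(s in `]0%R, T[) normL 2%:E (component (f s)))%E).
  apply: ge0_le_integral => //.
  - by move=> t _; rewrite lee_fin.
  - by apply/measurable_EFinP; exact: mF.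
  - apply: (@measurable_funS _ _ _ _ `[0, T]%classic) => //; first exact: subset_itv_oo_cc.
    exact: measurable_normL2.
  - move=> t _; rewrite /F; have := normL_ge0 2%:E (component (f t)).
    by case: (normL _ _) => //= _; rewrite leey.
apply: ge0_subset_integral => //; first exact: measurable_normL2.
exact: subset_itv_oo_cc.
Qed.

Let iF : leb.-integrable `]0, T[ (EFin \o F).
Proof.
apply/integrableP; split; first by apply/measurable_EFinP; exact: mF.
under eq_integral do rewrite /= ger0_norm//.
exact: le_lt_trans F_le f_lty.
Qed.

(** Both passes at almost every time. The second is conditional: the square integrability of [u t]
    comes only from integrating the first. *)
Let rate_bounds : {ae leb, forall t, t \in `]0, T[ ->
  (forall n, D n t <= 2 * Num.sqrt (E n t) * (C + F t)) /\
  (vintegrable (fun x => sqn (u t x)) -> exists2 e : nat -> R, e @ \oo --> (0 : R) &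
    forall n, D n t <= 2 * Num.sqrt (E n t) * F t + e n)}.
Proof.
have hF := @integrable_ae _ _ _ leb _ (measurable_itv `[0, T]) _ iFE.
apply: (ae_imp _ (ae_and (ae_and hM hG) hF)) => t [[hMt hGt] hFt] tT.
have tT' : t \in `[0, T] by exact: subset_itv_oo_cc tT.
have t0T := itvP tT.
have [_ _ c2 _ _] := hu.
have cui i : C2 (component (u t) i) := c2 t i t0T.
have uM : forall x, sqn (u t x) <= M ^+ 2.
  exact: (normLoo_le (a := component (u t)) M0 (fun i => C1_continuous (cui i).1) (hMt tT')).
have iG : vintegrable (grad_sqn (u t)).
  apply: (normL2_lty (a := nabla (u t))); last exact: le_lt_trans (hGt tT') (ltry _).
  apply: continuous_vmeasurable; apply: continuous_sumf => ij; apply: continuousXf.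
  exact: (cui ij.1).1.2.
have GG : Num.sqrt (vint (grad_sqn (u t))) <= G.
  by have := hGt tT'; rewrite (normL2_integrable (a := nabla (u t)) iG) lee_fin.
have cf := (hf_dom t0T).1.
have f_fin : normL 2%:E (component (f t)) \is a fin_num by exact: hFt.
have i_f : vintegrable (fun x => sqn (f t x)).
  apply: (normL2_lty (a := component (f t))); last by rewrite -ge0_fin_numE.
  by apply: continuous_vmeasurable; apply: continuous_sqnf => i; exact: C1_continuous.
have FE : F t = Num.sqrt (vint (fun x => sqn (f t x))).
  by rewrite /F (normL2_integrable (a := component (f t)) i_f).
have [p [cp lp eqn ip]] := pressure_exists (hadv_dom t0T) (hf_dom t0T)
  (fun x => heq x t0T).
have ca := (hadv_dom t0T).1; have [_ divu] := hudiv t0T.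
rewrite FE; split=> [n|iu].
  have r1 : 1 <= n.+1%:R :> R by rewrite ler1n.
  have := energy_rate_le (ltW hnu) M0 cui ca cf cp lp eqn uM iG i_f ip r1.
  rewrite /D /E clamp_id// => H; apply: (le_trans H).
  apply: ler_wpM2l; first by rewrite mulr_ge0// sqrtr_ge0.
  by rewrite lerD2r; apply: ler_wpM2l => //; rewrite addr_ge0// mulr_ge0// ltW.
have [e e0 He] := energy_rate_cvg (ltW hnu) M0 cui divu ca cf cp lp eqn uM iG i_f ip iu.
by exists e => // n; rewrite /E clamp_id//; exact: He.
Qed.

Let E0 n t : 0 <= E n t. Proof. exact: local_energy_ge0. Qed.

Let cE n : continuous (E n).
Proof. by have [cu' _ _ _ _] := hu; apply: continuous_local_energy => //; exact: ltW. Qed.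

Let dE n t : t \in `]0, T[ -> is_derive t 1 (E n) (D n t).
Proof. by move=> tT; have [] := is_derive_local_energy (ltr0Sn R n) hT hu tT. Qed.

Let cD n t : t \in `]0, T[ -> {for t, continuous (D n)}.
Proof. by move=> tT; have [] := is_derive_local_energy (ltr0Sn R n) hT hu tT. Qed.

(** * The limit in the radius, for a fixed [eta] *)

Section regularized.
Variable eta : R.
Hypothesis eta0 : 0 < eta.

Let X n := excess eta (E n) (D n) F.

Let den n t : 0 < 2 * Num.sqrt (E n t + eta).
Proof. by rewrite mulr_gt0// sqrtr_gt0 ltr_wpDl. Qed.

Let X0 n t : 0 <= X n t. Proof. by rewrite le_max lexx. Qed.

Let C0 : 0 <= C.
Proof. by rewrite mulr_ge0// addr_ge0// mulr_ge0// ltW. Qed.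

Let sqrtE_le n t : Num.sqrt (E n t) <= Num.sqrt (E n t + eta).
Proof. by apply: ler_wsqrtr; rewrite lerDl ltW. Qed.

(** Since [sqrt E <= sqrt (E + eta)], the division leaves [C + F t], a bound independent of the
    radius and of [eta]. *)
Let X_le n : {ae leb, forall t, t \in `]0, T[ -> X n t <= C}.
Proof.
apply: (ae_imp _ rate_bounds) => t + tT => /(_ tT)[/(_ n) H _].
rewrite /X /excess ge_max C0/= lerBlDr /sqrt_rate ler_pdivrMr//.
apply: (le_trans H); rewrite mulrC; apply: ler_wpM2l; first exact: addr_ge0.
by rewrite ler_pM2l.
Qed.

Let mX n : measurable_fun `]0, T[ (X n).
Proof. exact: (measurable_excess eta0 (@cE n) (E0 n) (@cD n) mF). Qed.

Let intC : (\int[leb]_(t in `]0%R, T[) (cst C%:E) t = (C * T)%:E)%E.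
Proof.
rewrite integral_cst; last exact: measurable_itv.
have lT : leb `]0, T[ = T%:E by rewrite lebesgue_measure_itv/= lte_fin hT -EFinB subr0.
exact: (congr1 (mule C%:E) lT).
Qed.

Let intX_le n : (\int[leb]_(t in `]0%R, T[) (X n t)%:E <= (C * T)%:E)%E.
Proof.
apply: (@le_trans _ _ (\int[leb]_(t in `]0%R, T[) (cst C%:E) t)%E).
  apply: ae_ge0_le_integral => //.
  - by move=> t _; rewrite lee_fin.
  - by apply/measurable_EFinP; exact: (@mX n).
  - by apply: (ae_imp _ (X_le n)) => t h /= tT; rewrite lee_fin; exact: h.
by rewrite intC.
Qed.

Let iX n : leb.-integrable `]0, T[ (EFin \o X n).
Proof.
apply/integrableP; split; first by apply/measurable_EFinP; exact: (@mX n).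
under eq_integral do rewrite /= ger0_norm//.
exact: le_lt_trans (intX_le n) (ltry _).
Qed.

Let RX_le n : \int[leb]_(t in `]0, T[) X n t <= C * T.
Proof.
rewrite -lee_fin /Rintegral fineK; first exact: intX_le.
exact: integrable_fin_num (iX n).
Qed.

Let iu0 : vintegrable (fun x => sqn (u 0 x)).
Proof.
apply: (normL2_lty (a := component (u 0))) => //.
by apply: continuous_vmeasurable; apply: continuous_sqnf; exact: cu.
Qed.

Let U0 := vint (fun x => sqn (u 0 x)).
Let IF := \int[leb]_(t in `]0, T[) F t.

Let E0_le n : E n 0 <= U0.
Proof.
rewrite /E clamp_id//; apply: (le_vint _ iu0).
  exact: (vintegrable_local_energy (ltr0Sn R n) (cu in0)).
by move=> x; rewrite ler_piMl ?sqn_ge0// bump_le1.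
Qed.

Let growth n s : 0 < s <= T -> Num.sqrt (E n s + eta) <=
  Num.sqrt (U0 + eta) + (IF + \int[leb]_(t in `]0, T[) X n t).
Proof.
move=> sT; apply: (le_trans (sqrt_growth eta0 (@cE n) (E0 n) (@dE n) (@cD n) F0 iF (iX n) sT)).
by rewrite lerD2r; apply: ler_wsqrtr; rewrite lerD2r.
Qed.

(* The first pass: the constant [C] bounds the excess uniformly in the radius. *)
Lemma finite_energy s : s \in `]0, T] -> vintegrable (fun x => sqn (u s x)).
Proof.
move=> sT; have sT' : s \in `[0, T] by exact: subset_itv_oc_cc sT.
pose K := Num.sqrt (U0 + eta) + (IF + C * T).
apply: (@local_energy_bounded_integrable _ _ _ (K ^+ 2)); first exact: cu.
move=> n; have sT0 : 0 < s <= T by move: sT; rewrite in_itv.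
have H : Num.sqrt (E n s + eta) <= K.
  by apply: (le_trans (growth n sT0)); rewrite !lerD2l.
have K0 : 0 <= K by apply: le_trans H; exact: sqrtr_ge0.
have : E n s + eta <= K ^+ 2.
  rewrite -[leLHS]sqr_sqrtr; last by rewrite addr_ge0// ltW.
  by rewrite lerXn2r ?nnegrE ?sqrtr_ge0.
by rewrite /E clamp_id//; apply: le_trans; rewrite lerDl ltW.
Qed.

(** The error [e n] is divided by at least [2 sqrt eta], which stays fixed as [n] grows. *)
Let X_cvg : {ae leb, forall t, t \in `]0, T[ -> X n t @[n --> \oo] --> (0 : R)}.
Proof.
apply: (ae_imp _ rate_bounds) => t + tT => /(_ tT)[_ H].
have [|e e0 He] := H; first by apply: finite_energy; exact: subset_itv_oo_oc tT.
have se0 : 0 < 2 * Num.sqrt eta by rewrite mulr_gt0// sqrtr_gt0.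
apply: (@squeeze_cvgr _ _ _ _ (cst 0) (fun n => `|e n| / (2 * Num.sqrt eta))).
- apply: nearW => n; rewrite X0/= /X /excess ge_max (divr_ge0 _ (ltW se0))//= lerBlDr.
  rewrite /sqrt_rate ler_pdivrMr// mulrDl addrC (le_trans (He n))//.
  apply: lerD.
    by rewrite mulrC; apply: ler_wpM2l => //; rewrite ler_pM2l.
  rewrite mulrAC ler_pdivlMr// (le_trans (ler_norm _))// normrM (gtr0_norm se0).
  apply: ler_wpM2l => //; rewrite ler_pM2l//; apply: ler_wsqrtr.
  by rewrite lerDr.
- exact: cvg_cst.
- have <- : `|0 : R| / (2 * Num.sqrt eta) = 0 by rewrite normr0 mul0r.
  by apply: cvgM; [exact: cvg_norm|exact: cvg_cst].
Qed.

Let intX_cvg : \int[leb]_(t in `]0, T[) X n t @[n --> \oo] --> (0 : R).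
Proof.
have iC : leb.-integrable `]0, T[ (fun=> C%:E).
  apply/integrableP; split; first exact: measurable_cst.
  under eq_integral do rewrite gee0_abs//.
  by move: intC; rewrite /cst => ->; rewrite ltry.
have mX' n : measurable_fun `]0, T[ (fun t => (X n t)%:E) by apply/measurable_EFinP; exact: (@mX n).
have cX : {ae leb, forall t, `]0, T[%classic t ->
    (X n t)%:E @[n --> \oo] --> (0 : R)%:E}.
  by apply: (ae_imp _ X_cvg) => t h tT; apply: cvg_EFin; [exact: nearW|exact: h].
have bX : {ae leb, forall t n, `]0, T[%classic t -> (`|(X n t)%:E| <= C%:E)%E}.
  apply/ae_foralln => n; apply: (ae_imp _ (X_le n)) => t h tT.
  by rewrite gee0_abs lee_fin//; exact: h.
have [_ _] := @dominated_convergence _ _ _ leb _ (measurable_itv `]0, T[) _ (cst 0%E) _ mX' (measurable_cst _) cX iC bX.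
rewrite integral0 => H; apply: fine_cvg; exact: H.
Qed.

Lemma regularized_energy_inequality :
  Num.sqrt (vint (fun x => sqn (u T x)) + eta) <= Num.sqrt (U0 + eta) + IF.
Proof.
have inoc : T \in `]0, T] by rewrite in_itv/= hT lexx.
have TT : 0 < T <= T by rewrite hT lexx.
have EC : E n T @[n --> \oo] --> vint (fun x => sqn (u T x)).
  rewrite /E clamp_id//; apply: cvg_local_energy; first exact: cu.
  exact: finite_energy.
have C1 : Num.sqrt (E n T + eta) @[n --> \oo] --> Num.sqrt (vint (fun x => sqn (u T x)) + eta).
  apply: (@cvg_comp _ _ _ (fun n => E n T + eta) Num.sqrt); last exact: sqrt_continuous.
  by apply: cvgD; [exact: EC|exact: cvg_cst].
have C2 : Num.sqrt (U0 + eta) + (IF + \int[leb]_(t in `]0, T[) X n t) @[n --> \oo] -->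
    Num.sqrt (U0 + eta) + (IF + 0).
  apply: cvgD; first exact: cvg_cst.
  by apply: cvgD; [exact: cvg_cst|exact: intX_cvg].
rewrite addr0 in C2.
by apply: (ler_cvg_to C1 C2); apply: nearW => n; exact: growth.
Qed.

End regularized.

Lemma energy_inequality : (normL 2%:E (component (u T)) <=
  normL 2%:E (component (u 0)) +
  \int[leb]_(s in `[0%R, T]) normL 2%:E (component (f s)))%E.
Proof.
have inoc : T \in `]0, T] by rewrite in_itv/= hT lexx.
(* Any positive [eta] serves here; 1 is taken. *)
have iuT : vintegrable (fun x => sqn (u T x)) by exact: (finite_energy ltr01).
have iu0 : vintegrable (fun x => sqn (u 0 x)).
  apply: (normL2_lty (a := component (u 0))) => //.
  by apply: continuous_vmeasurable; apply: continuous_sqnf; exact: cu.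
rewrite (normL2_integrable (a := component (u T)) iuT).
rewrite (normL2_integrable (a := component (u 0)) iu0).
apply: (@le_trans _ _ ((Num.sqrt (vint (sumsq (component (u 0)))))%:E +
  \int[leb]_(t in `]0%R, T[) (F t)%:E)%E); last by rewrite leeD2l.
rewrite -[X in (_ + X)%E]fineK; last exact: integrable_fin_num iF.
rewrite -EFinD lee_fin; apply/ler_addgt0Pr => e e0.
(* The choice [eta = e^2] costs at most [e], since [sqrt (B + e^2) <= sqrt B + e]. *)
have e20 : 0 < e ^+ 2 by rewrite exprn_gt0.
have := regularized_energy_inequality e20.
set A := vint (fun x => sqn (u T x)); set B := vint (fun x => sqn (u 0 x)).
have A0 : 0 <= A by apply: vint_sqn_ge0.
have B0 : 0 <= B by apply: vint_sqn_ge0.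
have H1 : Num.sqrt A <= Num.sqrt (A + e ^+ 2) by apply: ler_wsqrtr; rewrite lerDl ltW.
have H2 : Num.sqrt (B + e ^+ 2) <= Num.sqrt B + e.
  have e0' := ltW e0.
  rewrite -[leRHS]ger0_norm ?addr_ge0 ?sqrtr_ge0// -sqrtr_sqr; apply: ler_wsqrtr.
  rewrite sqrrD sqr_sqrtr// lerD2r lerDl mulrn_wge0// mulr_ge0 ?sqrtr_ge0//.
move=> H3; apply: (le_trans H1); apply: (le_trans H3).
by rewrite addrAC lerD2r.
Qed.

End energy_inequality.

Theorem theorem1 (R : realType) (d : nat) (nu T : R)
    (u0 : 'rV[R]_d -> 'rV[R]_d) (f u : R -> 'rV[R]_d -> 'rV[R]_d) (eps : R)
    (hnu : 0 < nu) (hT : 0 < T)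
    (hu0 : divergence_free u0)
    (hf : measurable_field T f)
    (hu : classical T u)
    (hudiv : forall t, 0 < t < T -> divergence_free (u t))
    (hadv_dom : forall t, 0 < t < T -> Leray_dom (advect (u t)))
    (hf_dom : forall t, 0 < t < T -> Leray_dom (f t))
    (heq : forall t x, 0 < t < T ->
      derive1 (u ^~ x) t + Leray (advect (u t)) x
        = nu *: vlaplacian (u t) x + Leray (f t) x)
    (hinit : forall x, u 0 x = u0 x)
    (heps : 0 < eps < 1)
    (hXi : forall t i j k x, 0 < t < T ->
      derivable (partial j (component (Xi (advect (u t))) i)) x (delta_mx 0 k))
    (h1 : (normLooL T +oo (fun t => component (u t)) < +oo)%E)
    (h2 : (normLooL T +oo (fun t => nabla (u t)) < +oo)%E)
    (h3 : (normLooL T 2%:E (fun t => nabla (u t)) < +oo)%E)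
    (h4 : (normLooL T (2 - eps)%:E (fun t => nabla2 (u t)) < +oo)%E)
    (h5 : (normLooL T +oo (fun t => nabla (Xi (advect (u t)))) < +oo)%E)
    (h6 : (normLooL T +oo (fun t => nabla2 (Xi (advect (u t)))) < +oo)%E) :
  (normL 2%:E (component (u T)) <=
    normL 2%:E (component u0)
      + \int[lebesgue_measure]_(s in `[0%R, T]) normL 2%:E (component (f s)))%E.
Proof.
rewrite -(funext hinit : u 0 = u0).
have [M M0 hM] := normLooL_lty h1; have [G G0 hG] := normLooL_lty h3.
have nge (I : finType) (a : I -> 'rV[R]_d -> R) : (0 <= normL 2%:E a)%E by exact: Lnorm_ge0.
have Ige : (0 <= \int[lebesgue_measure]_(s in `[0%R, T]) normL 2%:E (component (f s)))%E.
  by apply: integral_ge0.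
(* If a term on the right is [+oo], so is the sum, the other term being nonnegative. This leaves
   finite initial energy and integrable forcing. *)
have [u0_lty|] := ltP (normL 2%:E (component (u 0))) +oo%E; last first.
  rewrite leye_eq => /eqP ->; rewrite addye ?leey//.
  by rewrite gt_eqF// (lt_le_trans _ Ige)// ltNy0.
have [f_lty|] := ltP (\int[lebesgue_measure]_(s in `[0%R, T]) normL 2%:E (component (f s)))%E +oo%E;
    last first.
  rewrite leye_eq => /eqP ->; rewrite addey ?leey//.
  by rewrite gt_eqF// (lt_le_trans _ (nge _ _))// ltNy0.
exact: (energy_inequality hnu hT hf hu hudiv hadv_dom hf_dom heq M0 G0 hM hG f_lty u0_lty).
Qed.
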